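(* Let $\mathbb{K}$ be a commutative ring, let $k,l$ be positive integers such that $k\cdot1_{\mathbb{K}}$ and $l\cdot1_{\mathbb{K}}$ are invertible in $\mathbb{K}$, and let $Q$ be a quiver of power strictly less than $k$ and strictly less than $l$. Then there are isomorphisms $$\Omega^{(k)}Q\cong\Omega^{(l)}Q,\qquad H^{(k)}_*(Q)\cong H^{(l)}_*(Q),$$ the first being an isomorphism of chain complexes.
   Context: Quivers. A quiver $Q$ consists of sets $Q_0,Q_1$ and maps $h,t:Q_1\to Q_0$, $s:Q_0\to Q_1$ with $hs=\mathrm{id}=ts$. Elements of $s(Q_0)$ are degenerate arrows ($1_v=s(v)$), the other elements of $Q_1$ are non-degenerate. $Q(u,v)=\{\alpha\in Q_1\mid t(\alpha)=u,h(\alpha)=v\}$. The power of $Q$ is the supremum of the cardinalities of the sets $Q(v,v')$, $v,v'\in Q_0$. An embedding of quivers is an injective map on vertices and arrows commuting with $h,t,s$. The operator $\omega$. For a non-negatively graded chain complex $C$ and graded submodule $D\subseteq C$, $\omega(C,D)$ is the subcomplex with $\omega(C,D)_n=D_n\cap\partial^{-1}(D_{n-1})$. For a simplicial module $A$, $\mathsf{N}A$ is the Moore complex, identified with the quotient of the unnormalized complex ($A_n$, $\sum(-1)^id_i$) by its degenerate subcomplex; for a sequence of submodules $B_n\subseteq A_n$ let $\overline{B}_n$ be the image of $B_n$ in $\mathsf{N}_nA$. Linear nerve. An augmented linear category is a $\mathbb{K}$-linear category $\mathcal{A}$ with a linear functor $\varepsilon$ from $\mathcal{A}$ to the one-object linear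 category with endomorphism ring $\mathbb{K}$. Its linear nerve is the simplicial module with $\mathsf{Lnerve}(\mathcal{A})_0=\mathbb{K}[\mathrm{ob}\,\mathcal{A}]$ and $\mathsf{Lnerve}(\mathcal{A})_n=\bigoplus_{a_0,\dots,a_n}\mathcal{A}(a_0,a_1)\otimes\dots\otimes\mathcal{A}(a_{n-1},a_n)$; for $n\ge2$, $d_0(\alpha_1\otimes\dots\otimes\alpha_n)=\varepsilon(\alpha_1)\alpha_2\otimes\dots\otimes\alpha_n$, $d_n(\alpha_1\otimes\dots\otimes\alpha_n)=\alpha_1\otimes\dots\otimes\alpha_{n-1}\varepsilon(\alpha_n)$, $d_i$ ($1\le i\le n-1$) replaces $\alpha_i\otimes\alpha_{i+1}$ by $\alpha_{i+1}\circ\alpha_i$, $s_i$ inserts the identity $1_{a_i}$; for $n=1$ and $\alpha:a_0\to a_1$, $d_0(\alpha)=\varepsilon(\alpha)a_1$, $d_1(\alpha)=\varepsilon(\alpha)a_0$; and $s_0(a)=1_a$. $k$-power complex. Assume $k\cdot1_{\mathbb{K}}$ is invertible. For a set $V$, $\mathsf{Q}^k_V$ is the quiver with vertex set $V$ and exactly $k$ non-degenerate arrows $\alpha_1^{v,v'},\dots,\alpha_k^{v,v'}$ from $v$ to $v'$ for every $v,v'\in V$ (including $v=v'$). $\mathcal{A}^k_V$ is the augmented linear category with object set $V$, $\mathcal{A}^k_V(v,v')=\mathbb{K}[\mathsf{Q}^k_V(v,v')]$, identities $1_v$, composition $\alpha_n^{v',v''}\circ\alpha_m^{v,v'}=\frac1k\sum_{i=1}^k\alpha_i^{v,v''}$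 for all $m,n$, and $\varepsilon(\alpha_i^{v,v'})=1$, $\varepsilon(1_v)=1$. For a quiver $Q$ of power at most $k$ with $V=Q_0$, choose an embedding $i:Q\to\mathsf{Q}^k_V$ that is the identity on vertices; then $\Omega^{(k)}Q=\omega(\mathsf{N}\,\mathsf{Lnerve}(\mathcal{A}^k_V),\overline{B})$, where $B_0=\mathbb{K}[V]$ and $B_n$ is spanned by all $\alpha_1\otimes\dots\otimes\alpha_n$ with $\alpha_j\in i(Q_1)$ composable. This is independent of $i$ up to canonical isomorphism. $H^{(k)}_*(Q)=H_*(\Omega^{(k)}Q)$ is the $k$-power homology. *)

(* Defs.v *)
From HB Require Import structures.
From mathcomp Require Import all_boot all_algebra.
From mathcomp Require Import finmap.
From mathcomp Require Import boolp classical_sets functions cardinality.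
From mathcomp.multinomials Require Import monalg.

Set Implicit Arguments.
Unset Strict Implicit.
Unset Printing Implicit Defensive.

Import GRing.Theory.
Local Open Scope classical_set_scope.
Local Open Scope quotient_scope.
Local Open Scope ring_scope.

Definition mk_linear (K : pzRingType) (U V : lmodType K) (f : U -> V)
    (hf : linear f) : {linear U -> V} :=
  HB.pack_for {linear U -> V} f (GRing.isLinear.Build K U V _ f hf).

Lemma mk_linearE (K : pzRingType) (U V : lmodType K) (f : U -> V)
    (hf : linear f) x : mk_linear hf x = f x.
Proof. by []. Qed.

Section FreeModule.
Variables (K : pzRingType) (X : Type).

(* [{malg K[_]}] has a module structure in the library only over nontrivial
   rings; the one declared here makes the zero ring admissible. *)
Definition free_mod : Type := {malg K[{classic X}]}.

HB.instance Definition _ := GRing.Zmodule.on free_mod.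

Definition free_scale (r : K) (g : free_mod) : free_mod :=
  [malg x in msupp g => r * g@_x].

Lemma free_scaleE r g (x : {classic X}) : (free_scale r g)@_x = r * g@_x.
Proof. by rewrite mcoeffE; case: msuppP; rewrite ?mulr0. Qed.

Lemma free_scaleA r s g : free_scale r (free_scale s g) = free_scale (r * s) g.
Proof. by apply/malgP=> x; rewrite !free_scaleE mulrA. Qed.

Lemma free_scale1 : left_id 1 free_scale.
Proof. by move=> g; apply/malgP=> x; rewrite free_scaleE mul1r. Qed.

Lemma free_scaleDr : right_distributive free_scale +%R.
Proof.
by move=> r g h; apply/malgP=> x; rewrite free_scaleE !mcoeffD !free_scaleE mulrDr.
Qed.

Lemma free_scaleDl g : {morph free_scale^~ g : r s / r + s}.
Proof.
by move=> r s; apply/malgP=> x; rewrite free_scaleE !mcoeffD !free_scaleE mulrDl.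
Qed.

HB.instance Definition _ := GRing.Zmodule_isLmodule.Build K free_mod
  free_scaleA free_scale1 free_scaleDr free_scaleDl.

Definition fbasis (x : X) : free_mod := mkmalgU (x : {classic X}) (1 : K).

Lemma mcoeff_free_scale r (g : free_mod) (x : {classic X}) :
  mcoeff x (r *: g) = r * mcoeff x g.
Proof. exact: free_scaleE. Qed.

Section Lift.
Variables (M : lmodType K) (phi : X -> M).

Definition free_lift_fun (g : free_mod) : M :=
  \sum_(x <- msupp g) g@_x *: phi x.

Lemma free_lift_funw (d : {fset {classic X}}) (g : free_mod) :
  fsubset (msupp g) d -> free_lift_fun g = \sum_(x <- d) g@_x *: phi x.
Proof.
move=> le; rewrite /free_lift_fun (big_fset_incl _ le) //= => x _ /mcoeff_outdom ->.
by rewrite scale0r.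
Qed.

Lemma free_lift_linear : linear free_lift_fun.
Proof.
move=> r g h; pose d := (msupp g `|` msupp h `|` msupp (r *: g + h))%fset.
rewrite !(@free_lift_funw d) /d; first last.
- exact: fsubsetUr.
- by rewrite (fsubset_trans _ (fsubsetUl _ _)) // fsubsetUl.
- by rewrite (fsubset_trans _ (fsubsetUl _ _)) // fsubsetUr.
rewrite scaler_sumr -big_split /=; apply: eq_bigr => x _.
by rewrite mcoeffD mcoeff_free_scale scalerDl scalerA.
Qed.

Definition free_lift : {linear free_mod -> M} := mk_linear free_lift_linear.

Lemma free_lift_basis x : free_lift (fbasis x) = phi x.
Proof.
rewrite mk_linearE (@free_lift_funw [fset (x : {classic X})]%fset) ?msuppU_le //.
by rewrite big_seq_fset1 mcoeffUU scale1r.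
Qed.

End Lift.

Lemma free_expand (g : free_mod) : g = \sum_(x <- msupp g) g@_x *: fbasis x.
Proof.
rewrite {1}[g]monalgE; apply: eq_bigr => x _; apply/malgP => y.
by rewrite mcoeff_free_scale !mcoeffU mulrnAr mulr1.
Qed.

Lemma free_ext (M : lmodType K) (f g : {linear free_mod -> M}) :
  (forall x, f (fbasis x) = g (fbasis x)) -> f =1 g.
Proof.
move=> fg x; rewrite [x]free_expand !linear_sum; apply: eq_bigr => i _.
by rewrite !linearZ /= fg.
Qed.

End FreeModule.

Arguments fbasis K {X} x.

Section Submodules.
Variables (K : pzRingType) (V : lmodType K).

Section Span.
Variable A : set V.

Definition span_pred : {pred V} := fun v =>
  `[< forall S : submodClosed V, (forall a, A a -> a \in S) -> v \in S >].

Lemma span_closed : subsemimod_closed span_pred.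
Proof.
split; first split; rewrite /span_pred.
- by rewrite unfold_in; apply/asboolP => S _; rewrite rpred0.
- move=> u v; rewrite !unfold_in => /asboolP hu /asboolP hv.
  by apply/asboolP => S AS; rewrite rpredD ?hu ?hv.
- move=> r v; rewrite !unfold_in => /asboolP hv.
  by apply/asboolP => S AS; rewrite rpredZ ?hv.
Qed.

HB.instance Definition _ := GRing.isSubmodClosed.Build K V span_pred span_closed.

Definition span : submodClosed V := span_pred.

Lemma mem_span a : A a -> a \in span.
Proof. by move=> Aa; apply/asboolP => S; apply. Qed.

Lemma span_ind (S : submodClosed V) :
  (forall a, A a -> a \in S) -> forall v, v \in span -> v \in S.
Proof. by move=> AS v /asboolP; apply. Qed.

End Span.

Section SubType.
Variable S : submodClosed V.

Record submod : Type := Submod { submod_val : V; _ : submod_val \in S }.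

HB.instance Definition _ := [isSub for submod_val].
HB.instance Definition _ := [Choice of submod by <:].
HB.instance Definition _ := GRing.SubChoice_isSubLmodule.Build K V _ submod
  (GRing.submod_closed_semi (submodClosedP S)).

End SubType.

Section Quotient.
Variable S : submodClosed V.

Definition quot_pred : {pred V} := S.

Lemma quot_pred_closed : zmod_closed quot_pred.
Proof.
split; rewrite /quot_pred ?rpred0 // => u v uS vS.
by rewrite -scaleN1r rpredD ?rpredZ.
Qed.

HB.instance Definition _ := GRing.isZmodClosed.Build V quot_pred quot_pred_closed.

Definition quot_mod : Type := Quotient.quot quot_pred.

HB.instance Definition _ := GRing.Zmodule.on quot_mod.

Definition quot_pi_fun (v : V) : quot_mod := \pi_(Quotient.quot quot_pred) v.
Definition quot_repr (x : quot_mod) : V := repr (x : Quotient.quot quot_pred).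

Lemma quot_reprK x : quot_pi_fun (quot_repr x) = x.
Proof. exact: (@reprK _ (Quotient.quot quot_pred)). Qed.

Lemma quot_pi_eq u v : quot_pi_fun u = quot_pi_fun v <-> u - v \in S.
Proof.
by split => [/eqP|h]; last apply/eqP;
   rewrite /quot_pi_fun -(Quotient.idealrBE quot_pred).
Qed.

Lemma quot_pi_add u v : quot_pi_fun (u + v) = quot_pi_fun u + quot_pi_fun v.
Proof. by rewrite /quot_pi_fun (Quotient.pi_add quot_pred). Qed.

Definition quot_scale (r : K) (x : quot_mod) : quot_mod :=
  quot_pi_fun (r *: quot_repr x).

Lemma quot_scale_pi r v : quot_scale r (quot_pi_fun v) = quot_pi_fun (r *: v).
Proof.
apply/quot_pi_eq; rewrite -scalerBr rpredZ //.
by apply/quot_pi_eq; rewrite quot_reprK.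
Qed.

Lemma quot_scaleA r s x : quot_scale r (quot_scale s x) = quot_scale (r * s) x.
Proof. by rewrite -[x]quot_reprK !quot_scale_pi scalerA. Qed.

Lemma quot_scale1 : left_id 1 quot_scale.
Proof. by move=> x; rewrite -[x]quot_reprK quot_scale_pi scale1r. Qed.

Lemma quot_scaleDr : right_distributive quot_scale +%R.
Proof.
move=> r x y; rewrite -[x]quot_reprK -[y]quot_reprK -quot_pi_add.
by rewrite !quot_scale_pi scalerDr quot_pi_add.
Qed.

Lemma quot_scaleDl x : {morph quot_scale^~ x : r s / r + s}.
Proof.
by move=> r s; rewrite -[x]quot_reprK !quot_scale_pi scalerDl quot_pi_add.
Qed.

HB.instance Definition _ := GRing.Zmodule_isLmodule.Build K quot_mod
  quot_scaleA quot_scale1 quot_scaleDr quot_scaleDl.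

Lemma quot_pi_linear : linear quot_pi_fun.
Proof. by move=> r u v; rewrite quot_pi_add -quot_scale_pi. Qed.

Definition quot_pi : {linear V -> quot_mod} := mk_linear quot_pi_linear.

Lemma quot_pi0 v : quot_pi v = 0 <-> v \in S.
Proof.
by rewrite -[X in _ = X](linear0 quot_pi) /= quot_pi_eq subr0.
Qed.

Lemma quot_pi_surj x : exists v, quot_pi v = x.
Proof. by exists (quot_repr x); rewrite mk_linearE quot_reprK. Qed.

Section Lift.
Variables (W : lmodType K) (f : {linear V -> W}).
Hypothesis f0 : forall v, v \in S -> f v = 0.

Definition quot_lift_fun (x : quot_mod) : W := f (quot_repr x).

Lemma quot_lift_fun_pi v : quot_lift_fun (quot_pi v) = f v.
Proof.
apply/eqP; rewrite -subr_eq0 -linearB f0 //.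
by apply/quot_pi_eq; rewrite quot_reprK.
Qed.

Lemma quot_lift_linear : linear quot_lift_fun.
Proof.
move=> r x y; have [u <-] := quot_pi_surj x; have [v <-] := quot_pi_surj y.
by rewrite -linearP !quot_lift_fun_pi linearP.
Qed.

Definition quot_lift : {linear quot_mod -> W} := mk_linear quot_lift_linear.

Lemma quot_lift_pi v : quot_lift (quot_pi v) = f v.
Proof. exact: quot_lift_fun_pi. Qed.

End Lift.
End Quotient.
End Submodules.

Section ImageKernel.
Variables (K : pzRingType) (V W : lmodType K) (f : {linear V -> W}).

Definition ker_pred : {pred V} := fun v => f v == 0.

Lemma ker_closed : subsemimod_closed ker_pred.
Proof.
split; first split; rewrite /ker_pred ?unfold_in.
- by rewrite linear0.
- by move=> u v; rewrite !unfold_in linearD => /eqP-> /eqP->; rewrite addr0.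
- by move=> r v; rewrite !unfold_in linearZ /= => /eqP->; rewrite scaler0.
Qed.

HB.instance Definition _ := GRing.isSubmodClosed.Build K V ker_pred ker_closed.

Definition ker_sub : submodClosed V := ker_pred.

Variable S : submodClosed V.

Definition image_pred : {pred W} := fun w => `[< exists2 v, v \in S & f v = w >].

Lemma image_closed : subsemimod_closed image_pred.
Proof.
split; first split; rewrite /image_pred.
- by rewrite unfold_in; apply/asboolP; exists 0; rewrite ?rpred0 ?linear0.
- move=> ? ?; rewrite !unfold_in => /asboolP[u uS <-] /asboolP[v vS <-].
  by apply/asboolP; exists (u + v); rewrite ?rpredD ?linearD.
- move=> r ?; rewrite !unfold_in => /asboolP[v vS <-].
  by apply/asboolP; exists (r *: v); rewrite ?rpredZ ?linearZ.
Qed.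

HB.instance Definition _ := GRing.isSubmodClosed.Build K W image_pred image_closed.

Definition image_sub : submodClosed W := image_pred.

Definition preimage_pred (T : submodClosed W) : {pred V} := fun v => f v \in T.

Lemma preimage_closed T : subsemimod_closed (preimage_pred T).
Proof.
split; first split; rewrite /preimage_pred.
- by rewrite unfold_in linear0 rpred0.
- by move=> u v uT vT; rewrite unfold_in linearD; apply: rpredD.
- by move=> r v vT; rewrite unfold_in linearZ; apply: rpredZ.
Qed.

HB.instance Definition _ T :=
  GRing.isSubmodClosed.Build K V (preimage_pred T) (preimage_closed T).

Definition preimage_sub (T : submodClosed W) : submodClosed V := preimage_pred T.

End ImageKernel.

Section TrivialSubmodules.
Variables (K : pzRingType) (V : lmodType K).

Definition full_pred : {pred V} := fun=> true.
Lemma full_closed : subsemimod_closed full_pred.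
Proof. by split; first split. Qed.
HB.instance Definition _ := GRing.isSubmodClosed.Build K V full_pred full_closed.
Definition full_sub : submodClosed V := full_pred.

Definition cap_pred (S T : submodClosed V) : {pred V} :=
  fun v => (v \in S) && (v \in T).
Lemma cap_closed S T : subsemimod_closed (cap_pred S T).
Proof.
split; first split; rewrite /cap_pred.
- by rewrite unfold_in !rpred0.
- by move=> u v /andP[? ?] /andP[? ?]; rewrite unfold_in !rpredD.
- by move=> r v /andP[? ?]; rewrite unfold_in !rpredZ.
Qed.
HB.instance Definition _ S T :=
  GRing.isSubmodClosed.Build K V (cap_pred S T) (cap_closed S T).
Definition cap_sub (S T : submodClosed V) : submodClosed V := cap_pred S T.

End TrivialSubmodules.

Section Inclusion.
Variables (K : pzRingType) (V : lmodType K) (S : submodClosed V).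

Lemma submod_val_linear : linear (@submod_val K V S).
Proof. by move=> r u v; rewrite -[LHS]/(val (r *: u + v)) linearP. Qed.

Definition submod_incl : {linear submod S -> V} := mk_linear submod_val_linear.

End Inclusion.

Record chain_complex (K : pzRingType) := ChainComplex {
  cmod :> nat -> lmodType K;
  bd : forall n, {linear cmod n.+1 -> cmod n};
  bd_bd : forall n x, bd n (bd n.+1 x) = 0
}.

Arguments bd {K} c n.

Section Homology.
Variables (K : pzRingType) (C : chain_complex K).

Definition cycles n : submodClosed (C n) :=
  match n with
  | 0 => full_sub (C 0)
  | m.+1 => ker_sub (bd C m)
  end.

(* The image of the boundary map, as a submodule of the cycles. *)
Definition boundaries n : submodClosed (submod (cycles n)) :=
  preimage_sub (submod_incl (cycles n))
    (image_sub (bd C n) (full_sub (C n.+1))).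

Definition homology n : lmodType K := quot_mod (boundaries n).

End Homology.

Definition module_iso (K : pzRingType) (V W : lmodType K) : Prop :=
  exists f : {linear V -> W}, bijective f.

Definition chain_iso (K : pzRingType) (C D : chain_complex K) : Prop :=
  exists f : forall n, {linear C n -> D n},
    (forall n, bijective (f n)) /\
    (forall n x, f n (bd C n x) = bd D n (f n.+1 x)).

Section Omega.
Variables (K : pzRingType) (C : chain_complex K).
Variable D : forall n, submodClosed (C n).

(* In degree 0 the boundary is zero, so the second condition is void. *)
Definition omega_sub n : submodClosed (C n) :=
  match n with
  | 0 => D 0
  | m.+1 => cap_sub (D m.+1) (preimage_sub (bd C m) (D m))
  end.

Lemma omega_bd_closed n (x : submod (omega_sub n.+1)) :
  bd C n (submod_val x) \in omega_sub n.
Proof.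
case: x => /= x /andP[_ dx]; case: n x dx => //= n x dx.
apply/andP; split; first exact: dx.
by rewrite unfold_in bd_bd rpred0.
Qed.

Definition omega_bd_fun n (x : submod (omega_sub n.+1)) : submod (omega_sub n) :=
  Submod (omega_bd_closed x).

Lemma omega_bd_linear n : linear (@omega_bd_fun n).
Proof.
move=> r x y; apply: val_inj.
apply: etrans (esym (submod_val_linear _ _ _)).
by apply: (etrans (congr1 (bd C n) (submod_val_linear _ _ _))); rewrite linearP.
Qed.

Definition omega_bd n : {linear submod (omega_sub n.+1) -> submod (omega_sub n)} :=
  mk_linear (@omega_bd_linear n).

Lemma omega_bd_bd n x : omega_bd n (omega_bd n.+1 x) = 0.
Proof. by apply: val_inj; rewrite linear0 /= bd_bd. Qed.

Definition omega : chain_complex K :=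
  @ChainComplex K (fun n => submod (omega_sub n)) omega_bd omega_bd_bd.

End Omega.

(* Only the faces [face n i] with i <= n.+1 and the degeneracies [degen n i] with
   i <= n are meaningful: the identities constrain no others. *)
Record simplicial_module (K : pzRingType) := SimplicialModule {
  smod :> nat -> lmodType K;
  face : forall n, nat -> {linear smod n.+1 -> smod n};
  degen : forall n, nat -> {linear smod n -> smod n.+1};
  face_face : forall n i j x, (i < j <= n.+2)%N ->
    face n i (face n.+1 j x) = face n j.-1 (face n.+1 i x);
  degen_degen : forall n i j x, (i <= j <= n)%N ->
    degen n.+1 i (degen n j x) = degen n.+1 j.+1 (degen n i x);
  face_degen_lt : forall n i j x, (i < j <= n.+1)%N ->
    face n.+1 i (degen n.+1 j x) = degen n j.-1 (face n i x);
  face_degen_id : forall n i x, (i <= n)%N -> face n i (degen n i x) = x;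
  face_degen_succ : forall n i x, (i <= n)%N -> face n i.+1 (degen n i x) = x;
  face_degen_gt : forall n i j x, (j.+1 < i <= n.+2)%N ->
    face n.+1 i (degen n.+1 j x) = degen n j (face n i.-1 x)
}.

Arguments face {K} s n i.
Arguments degen {K} s n i.

Section Moore.
Variables (K : comPzRingType) (A : simplicial_module K).

Definition unnorm_bd_fun n (x : A n.+1) : A n :=
  \sum_(i < n.+2) (-1) ^+ i *: face A n i x.

Lemma unnorm_bd_linear n : linear (@unnorm_bd_fun n).
Proof.
move=> r x y; rewrite /unnorm_bd_fun scaler_sumr -big_split /=.
apply: eq_bigr => i _; rewrite linearP scalerDr !scalerA.
by rewrite [r * _]mulrC.
Qed.

Definition unnorm_bd n : {linear A n.+1 -> A n} := mk_linear (@unnorm_bd_linear n).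

Lemma unnorm_bd_bd n x : unnorm_bd n (unnorm_bd n.+1 x) = 0.
Proof.
rewrite !mk_linearE /unnorm_bd_fun.
have -> : \sum_(i < n.+2) (-1) ^+ i *:
    face A n i (\sum_(j < n.+3) (-1) ^+ j *: face A n.+1 j x) =
  \sum_(i < n.+2) \sum_(j < n.+3)
    (-1) ^+ (i + j) *: face A n i (face A n.+1 j x).
  apply: eq_bigr => i _; rewrite linear_sum scaler_sumr; apply: eq_bigr => j _.
  by rewrite linearZ /= scalerA exprD.
rewrite pair_big /= (bigID (fun p : 'I_n.+2 * 'I_n.+3 => (p.1 < p.2)%N)) /=.
pose h (p : 'I_n.+2 * 'I_n.+3) : 'I_n.+2 * 'I_n.+3 :=
  (inord p.2.-1, inord p.1).
pose h' (p : 'I_n.+2 * 'I_n.+3) : 'I_n.+2 * 'I_n.+3 :=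
  (inord p.2, inord p.1.+1).
rewrite (reindex_onto h' h) /=; last first.
  case=> i j /= ij; have j0 : (0 < j)%N by apply: leq_ltn_trans ij.
  have jn : (j.-1 < n.+2)%N by rewrite prednK // -ltnS.
  by congr (_, _); apply: val_inj; rewrite /= ?inordK // ?prednK // (leq_trans (ltn_ord i)).
rewrite addrC; apply/eqP; rewrite addr_eq0 -sumrN; apply/eqP.
have hj (i : 'I_n.+2) (j : 'I_n.+3) : (j <= i)%N -> (inord j : 'I_n.+2) = j :> nat.
  by move=> ji; rewrite inordK // (leq_ltn_trans ji).
have hi (i : 'I_n.+2) : (inord i.+1 : 'I_n.+3) = i.+1 :> nat.
  by rewrite inordK // ltnS.
apply: eq_big => [[i j]|[i j]] /=; rewrite -leqNgt.
  apply/idP/idP => [ji|/andP[ij /eqP[_ /(congr1 val) /=]]].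
    by rewrite /h /= (hj i) // hi ltnS ji /= !inord_val.
  have jn := ltn_ord (inord j : 'I_n.+2).
  rewrite inordK; last by rewrite ltnS ltnW.
  by move=> jE; move: ij; rewrite hi jE.
move=> ji; rewrite (hj i) // hi -scaleNr addnS exprS mulN1r opprK addnC.
by rewrite (@face_face _ A n j i.+1 x) // ltnS ji ltn_ord.
Qed.

Definition degenerate_set n : set (A n.+1) :=
  [set y | exists i x, (i <= n)%N /\ y = degen A n i x].

Definition degenerate n : submodClosed (A n) :=
  match n with
  | 0 => span set0
  | m.+1 => span (@degenerate_set m)
  end.

Lemma degen_degenerate n i x : (i <= n)%N -> degen A n i x \in degenerate n.+1.
Proof. by move=> le; apply: mem_span; exists i, x. Qed.

Lemma unnorm_bd_degenerate n x :
  x \in degenerate n.+1 -> unnorm_bd n x \in degenerate n.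
Proof.
pose S := preimage_sub (unnorm_bd n) (degenerate n).
move: x; apply: (@span_ind _ _ _ S) => _ [j [y [jn ->]]]; rewrite unfold_in mk_linearE.
rewrite /unnorm_bd_fun.
have j1 : (j < n.+2)%N by rewrite ltnS (leq_trans jn).
have j2 : (j.+1 < n.+2)%N by rewrite ltnS.
rewrite (bigD1 (Ordinal j1)) //= (bigD1 (Ordinal j2)) /=; last first.
  by apply/eqP => /(congr1 val) /= /eqP; rewrite eqn_leq ltnn.
rewrite face_degen_id // face_degen_succ // exprS mulN1r scaleNr addrA subrr add0r.
apply: rpred_sum => i /andP[ij ij1]; apply: rpredZ.
have {}ij : i != j :> nat by [].
have {}ij1 : i != j.+1 :> nat by [].
case: n j jn y i ij ij1 {S j1 j2} => [|n] j jn y i ij ij1.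
  by move: jn ij ij1; rewrite leqn0 => /eqP->; case: i => [[|[|]]].
have [lt|ge] := ltnP i j.
  by rewrite face_degen_lt ?lt // degen_degenerate // -ltnS prednK // (leq_ltn_trans _ lt).
have lt : (j.+1 < i)%N by rewrite ltn_neqAle eq_sym ij1 ltn_neqAle eq_sym ij.
have iN : (i <= n.+2)%N by rewrite -ltnS ltn_ord.
rewrite face_degen_gt ?lt //; apply: degen_degenerate.
by rewrite -2!ltnS (leq_trans lt).
Qed.

Definition moore_mod n : lmodType K := quot_mod (degenerate n).

Lemma moore_bd_subproof n x :
  x \in degenerate n.+1 -> (quot_pi (degenerate n) \o unnorm_bd n) x = 0.
Proof. by move=> /unnorm_bd_degenerate /quot_pi0. Qed.

Definition moore_bd n : {linear moore_mod n.+1 -> moore_mod n} :=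
  quot_lift (@moore_bd_subproof n).

Lemma moore_bd_pi n x :
  moore_bd n (quot_pi (degenerate n.+1) x) = quot_pi (degenerate n) (unnorm_bd n x).
Proof. exact: quot_lift_pi. Qed.

Lemma moore_bd_bd n x : moore_bd n (moore_bd n.+1 x) = 0.
Proof.
have [y <-] := quot_pi_surj x.
by rewrite !moore_bd_pi unnorm_bd_bd linear0.
Qed.

(* The Moore complex, in its presentation as the quotient of the unnormalized
   complex by its degenerate subcomplex. *)
Definition moore : chain_complex K := ChainComplex moore_bd_bd.

End Moore.
Record aug_lincat (K : comPzRingType) := AugLinCat {
  ob :> Type;
  hom : ob -> ob -> lmodType K;
  idm : forall a, hom a a;
  mcomp : forall a b c, hom b c -> hom a b -> hom a c;
  mcomp_linearl : forall a b c r (g g' : hom b c) (f : hom a b),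
    mcomp (r *: g + g') f = r *: mcomp g f + mcomp g' f;
  mcomp_linearr : forall a b c r (g : hom b c) (f f' : hom a b),
    mcomp g (r *: f + f') = r *: mcomp g f + mcomp g f';
  mcomp_idl : forall a b (f : hom a b), mcomp (idm b) f = f;
  mcomp_idr : forall a b (f : hom a b), mcomp f (idm a) = f;
  mcompA : forall a b c d (h : hom c d) (g : hom b c) (f : hom a b),
    mcomp h (mcomp g f) = mcomp (mcomp h g) f;
  aug : forall a b, {linear hom a b -> K^o};
  aug_id : forall a, aug a a (idm a) = 1;
  aug_mcomp : forall a b c (g : hom b c) (f : hom a b),
    aug a c (mcomp g f) = (aug b c g : K) * aug a b f
}.

Arguments hom {K} _ _ _.
Arguments idm {K _} _.
Arguments mcomp {K _ _ _ _} g f.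
Arguments aug {K _ _ _}.

Section LinearNerve.
Variables (K : comPzRingType) (A : aug_lincat K).

(* [chain n a0]: composable strings alpha_1 : a0 -> a1, ..., alpha_n : _ -> an. *)
Inductive chain : nat -> A -> Type :=
| chain_nil (a : A) : chain 0 a
| chain_cons n (a b : A) (f : hom A a b) (c : chain n b) : chain n.+1 a.

Definition word n := {a : A & chain n a}.

(* [chain_lin r c c1 c2]: the strings c, c1, c2 agree except in one entry, in
   which c has r *: f + g, c1 has f and c2 has g. *)
Inductive chain_lin (r : K) :
  forall n a, chain n a -> chain n a -> chain n a -> Prop :=
| chain_lin_head n a b (f g : hom A a b) (c : chain n b) :
    chain_lin r (chain_cons (r *: f + g) c) (chain_cons f c) (chain_cons g c)
| chain_lin_tail n a b (f : hom A a b) (c c1 c2 : chain n b) :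
    chain_lin r c c1 c2 ->
    chain_lin r (chain_cons f c) (chain_cons f c1) (chain_cons f c2).

Definition multilinear_relations n : set (free_mod K (word n)) :=
  [set x | exists r a (c c1 c2 : chain n a), chain_lin r c c1 c2 /\
    x = fbasis K (existT _ a c)
        - (r *: fbasis K (existT _ a c1) + fbasis K (existT _ a c2))].

(* K[composable strings of length n] modulo multilinearity, i.e. the direct sum
   over a_0, ..., a_n of the tensor products A(a_0, a_1) (x) ... (x) A(a_(n-1), a_n);
   for n = 0 there are no relations and this is K[ob A]. *)
Definition lnerve_mod n : lmodType K := quot_mod (span (@multilinear_relations n)).

Definition tensor n (w : word n) : lnerve_mod n :=
  quot_pi (span (@multilinear_relations n)) (fbasis K w).

Lemma tensor_lin n r a (c c1 c2 : chain n a) : chain_lin r c c1 c2 ->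
  tensor (existT _ a c) = r *: tensor (existT _ a c1) + tensor (existT _ a c2).
Proof.
move=> h; apply/eqP; rewrite -subr_eq0 /tensor -linearP -linearB; apply/eqP/quot_pi0.
by apply: mem_span; exists r, a, c, c1, c2.
Qed.

Section Lift.
Variables (n : nat) (M : lmodType K) (phi : word n -> M).
Hypothesis phi_lin : forall r a (c c1 c2 : chain n a), chain_lin r c c1 c2 ->
  phi (existT _ a c) = r *: phi (existT _ a c1) + phi (existT _ a c2).

Lemma lnerve_lift_subproof x :
  x \in span (@multilinear_relations n) -> free_lift phi x = 0.
Proof.
move=> xS; apply/eqP; move: x xS.
apply: (@span_ind _ _ _ (ker_sub (free_lift phi))) => _ [r [a [c [c1 [c2 [h ->]]]]]].
by rewrite unfold_in linearB linearP !free_lift_basis (phi_lin h) subrr.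
Qed.

Definition lnerve_lift : {linear lnerve_mod n -> M} := quot_lift lnerve_lift_subproof.

Lemma lnerve_lift_tensor w : lnerve_lift (tensor w) = phi w.
Proof. by rewrite /lnerve_lift quot_lift_pi free_lift_basis. Qed.

End Lift.

Lemma lnerve_ext n (M : lmodType K) (f g : {linear lnerve_mod n -> M}) :
  (forall w, f (tensor w) = g (tensor w)) -> f =1 g.
Proof.
move=> fg x; have [y <-] := quot_pi_surj x.
pose f' : {linear _ -> _} := f \o quot_pi (span (@multilinear_relations n)).
pose g' : {linear _ -> _} := g \o quot_pi (span (@multilinear_relations n)).
exact: (@free_ext _ _ _ f' g' fg).
Qed.

(* The faces d_(i+1), which leave a_0 unchanged, on a single string; the augmentation
   of the dropped morphism is returned as a coefficient. *)
Fixpoint chain_face n a (c : chain n a) {struct c} : nat -> K * chain n.-1 a :=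
  match c in chain n a return nat -> K * chain n.-1 a with
  | chain_nil a => fun=> (1, chain_nil a)
  | chain_cons n a b f c =>
    match c in chain m b return
      hom A a b -> (nat -> K * chain m.-1 b) -> nat -> K * chain m a with
    | chain_nil _ => fun f _ _ => (aug f, chain_nil a)
    | chain_cons _ _ _ g c' => fun f rec i =>
      if i is i'.+1 then ((rec i').1, chain_cons f (rec i').2)
      else (1, chain_cons (mcomp g f) c')
    end f (chain_face c)
  end.

Definition chain_face0 n a (c : chain n a) : K * word n.-1 :=
  match c in chain n a return K * word n.-1 with
  | chain_nil a => (1, existT _ a (chain_nil a))
  | chain_cons n a b f c => (aug f : K, existT _ b c)
  end.

Definition word_face n (i : nat) (w : word n.+1) : K * word n :=
  if i is i'.+1
  then ((chain_face (projT2 w) i').1, existT _ _ (chain_face (projT2 w) i').2)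
  else chain_face0 (projT2 w).

Fixpoint chain_degen n a (c : chain n a) (i : nat) {struct c} : chain n.+1 a :=
  match c in chain n a return chain n.+1 a with
  | chain_nil a => chain_cons (idm a) (chain_nil a)
  | chain_cons n a b f c =>
    if i is i'.+1 then chain_cons f (chain_degen c i')
    else chain_cons (idm a) (chain_cons f c)
  end.

Definition word_degen n (i : nat) (w : word n) : word n.+1 :=
  existT _ _ (chain_degen (projT2 w) i).

Lemma chain_consP n a (c : chain n.+1 a) :
  exists b (f : hom A a b) (c' : chain n b), c = chain_cons f c'.
Proof.
refine (match c as c0 in chain m a0 return
          match m return chain m a0 -> Prop with
          | 0 => fun=> True
          | m'.+1 => fun c1 => exists b (f : hom A a0 b) (c' : chain m' b),
                       c1 = chain_cons f c'
          end c0 with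
        | chain_nil _ => I
        | chain_cons _ _ b f c' => ex_intro _ b (ex_intro _ f (ex_intro _ c' erefl))
        end).
Qed.

Lemma chain_nilP a (c : chain 0 a) : c = chain_nil a.
Proof.
refine (match c as c0 in chain m a0 return
          match m return chain m a0 -> Prop with
          | 0 => fun c1 => c1 = chain_nil a0
          | m'.+1 => fun=> True
          end c0 with
        | chain_nil a => erefl
        | chain_cons _ _ _ _ _ => I
        end).
Qed.

(* A multilinearity relation p = r * p1 + p2 between strings with coefficients, in
   which either the strings or the coefficients vary. *)
Definition scaled_lin (T : Type) (lin : T -> T -> T -> Prop) (r : K)
    (p p1 p2 : K * T) : Prop :=
  (p.1 = p1.1 /\ p.1 = p2.1 /\ lin p.2 p1.2 p2.2) \/
  (p.2 = p1.2 /\ p.2 = p2.2 /\ p.1 = r * p1.1 + p2.1).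

Lemma chain_face_lin n r a (c c1 c2 : chain n a) i : chain_lin r c c1 c2 ->
  scaled_lin (@chain_lin r n.-1 a) r
    (chain_face c i) (chain_face c1 i) (chain_face c2 i).
Proof.
move=> h; elim: h i => {n a c c1 c2} [n a b f g c|n a b f c c1 c2 h IH] i.
  case: c f g => [b'|m b' b'' f' c'] f g /=; first by right; rewrite /= linearP.
  case: i => [|i] /=; left; do ?split; rewrite /= ?mcomp_linearr; exact: chain_lin_head.
case: h f IH => {n b c c1 c2} [n b b' g g' c|n b b' g c c1 c2 h] f IH /=.
  case: i => [|i].
    by left; do ?split; rewrite /= mcomp_linearl; exact: chain_lin_head.
  case: (IH i) => [[e1 [e2 h]]|[e1 [e2 h]]]; [left|right]; do ?split => //=.
  - exact: chain_lin_tail.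
  - by rewrite e1.
  - by rewrite e2.
case: i => [|i].
  by left; do ?split; exact: chain_lin_tail.
case: (IH i) => [[e1 [e2 h']]|[e1 [e2 h']]]; [left|right]; do ?split => //=.
- exact: chain_lin_tail.
- by rewrite e1.
- by rewrite e2.
Qed.

Definition word_lin n (r : K) (w w1 w2 : word n) : Prop :=
  exists a (c c1 c2 : chain n a), [/\ chain_lin r c c1 c2,
    w = existT _ a c, w1 = existT _ a c1 & w2 = existT _ a c2].

Lemma chain_face0_lin n r a (c c1 c2 : chain n a) : chain_lin r c c1 c2 ->
  scaled_lin (@word_lin n.-1 r) r (chain_face0 c) (chain_face0 c1) (chain_face0 c2).
Proof.
case=> {n a c c1 c2} [n a b f g c|n a b f c c1 c2 h] /=.
  by right; do ?split => //=; rewrite linearP.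
by left; do ?split => //=; exists b, c, c1, c2.
Qed.

Lemma word_face_lin n i r (w w1 w2 : word n.+1) : word_lin r w w1 w2 ->
  scaled_lin (@word_lin n r) r (word_face i w) (word_face i w1) (word_face i w2).
Proof.
case=> a [c [c1 [c2 [h -> -> ->]]]]; case: i => [|i]; first exact: chain_face0_lin h.
case: (chain_face_lin i h) => [[e1 [e2 h']]|[e1 [e2 h']]]; [left|right]; do ?split => //=.
- by exists a, (chain_face c i).2, (chain_face c1 i).2, (chain_face c2 i).2.
- by rewrite e1.
- by rewrite e2.
Qed.

Definition tensor_face n i (w : word n.+1) : lnerve_mod n :=
  (word_face i w).1 *: tensor (word_face i w).2.

Lemma tensor_face_lin n i r a (c c1 c2 : chain n.+1 a) : chain_lin r c c1 c2 ->
  tensor_face i (existT _ a c) =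
  r *: tensor_face i (existT _ a c1) + tensor_face i (existT _ a c2).
Proof.
move=> h; have /(word_face_lin i) : word_lin r (existT _ a c) (existT _ a c1) (existT _ a c2).
  by exists a, c, c1, c2.
rewrite /tensor_face => -[[<- [<- [b [d [d1 [d2 [h' -> -> ->]]]]]]]|[<- [<- ->]]].
  by rewrite (tensor_lin h') scalerDr !scalerA mulrC.
by rewrite scalerDl scalerA.
Qed.

Lemma chain_degen_lin n r a (c c1 c2 : chain n a) i : chain_lin r c c1 c2 ->
  chain_lin r (chain_degen c i) (chain_degen c1 i) (chain_degen c2 i).
Proof.
move=> h; elim: h i => {n a c c1 c2} [n a b f g c|n a b f c c1 c2 h IH] [|i] /=.
- by do 2?constructor.
- exact: chain_lin_head.
- by do 2?constructor.
- exact: chain_lin_tail.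
Qed.

Lemma tensor_degen_lin n i r a (c c1 c2 : chain n a) : chain_lin r c c1 c2 ->
  tensor (word_degen i (existT _ a c)) =
  r *: tensor (word_degen i (existT _ a c1)) + tensor (word_degen i (existT _ a c2)).
Proof. by move=> h; apply: tensor_lin; apply: chain_degen_lin. Qed.

Definition lnerve_face n i : {linear lnerve_mod n.+1 -> lnerve_mod n} :=
  lnerve_lift (phi := tensor_face i) (@tensor_face_lin n i).

Definition lnerve_degen n i : {linear lnerve_mod n -> lnerve_mod n.+1} :=
  lnerve_lift (phi := fun w => tensor (word_degen i w)) (@tensor_degen_lin n i).

Lemma lnerve_face_tensor n i w :
  lnerve_face n i (tensor w) = (word_face i w).1 *: tensor (word_face i w).2.
Proof. exact: lnerve_lift_tensor. Qed.

Lemma lnerve_degen_tensor n i w :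
  lnerve_degen n i (tensor w) = tensor (word_degen i w).
Proof. exact: lnerve_lift_tensor. Qed.

Lemma chain_faceS n a b (f : hom A a b) (c : chain n.+1 b) i :
  chain_face (chain_cons f c) i.+1 =
  ((chain_face c i).1, chain_cons f (chain_face c i).2).
Proof. by have [b' [g [c' ->]]] := chain_consP c. Qed.

Lemma chain_degen0 n a (c : chain n a) : chain_degen c 0 = chain_cons (idm a) c.
Proof. by case: c. Qed.

Lemma chain_face_face n a (c : chain n.+2 a) i j : (i < j <= n.+1)%N ->
  ((chain_face c j).1 * (chain_face (chain_face c j).2 i).1,
   (chain_face (chain_face c j).2 i).2) =
  ((chain_face c i).1 * (chain_face (chain_face c i).2 j.-1).1,
   (chain_face (chain_face c i).2 j.-1).2).
Proof.
elim: n a c i j => [|n IH] a c i j.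
  have [b [f [c1 ->]]] := chain_consP c; have [b' [g [c2 ->]]] := chain_consP c1.
  rewrite [c2]chain_nilP; case: i j => [|i] [|[|j]] //= _.
  by rewrite aug_mcomp mul1r.
have [b [f [c1 ->]]] := chain_consP c; have [b' [g [c2 ->]]] := chain_consP c1.
have [b'' [h [c3 ->]]] := chain_consP c2.
case: i j => [|i] [|[|j]] //.
- by move=> _ /=; rewrite mcompA.
- by move=> _ /=; rewrite mulr1 mul1r.
- rewrite !ltnS => ij; move: {c2 h c3} (chain_cons _ _) (IH _ (chain_cons g (chain_cons h c3)) i j.+1 ij) => c2 E.
  by move: E; rewrite !chain_faceS => -[-> ->].
Qed.

Lemma chain_degen_degen n a (c : chain n a) i j : (i <= j <= n)%N ->
  chain_degen (chain_degen c j) i = chain_degen (chain_degen c i) j.+1.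
Proof.
elim: c i j => [{}a|{}n {}a b f c IH] [|i] [|j] //=; rewrite ?chain_degen0 //=.
by rewrite !ltnS => ij; rewrite IH.
Qed.

Lemma chain_face_degen_lt n a (c : chain n.+1 a) i j : (i < j <= n)%N ->
  chain_face (chain_degen c j.+1) i =
  ((chain_face c i).1, chain_degen (chain_face c i).2 j).
Proof.
elim: n a c i j => [|n IH] a c i [|j] //=; first by rewrite ltn0 andbF.
have [b [f [c1 ->]]] := chain_consP c; case: i => [|i] ij.
  by have [b' [g [c2 ->]]] := chain_consP c1.
rewrite [chain_degen _ _]/= chain_faceS IH //.
by have [b' [g [c2 ->]]] := chain_consP c1.
Qed.

Lemma chain_face_degen_id n a (c : chain n a) i : (i < n)%N ->
  chain_face (chain_degen c i.+1) i = (1, c).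
Proof.
elim: c i => [{}a|{}n {}a b f c IH] // [|i] ni.
  by rewrite [chain_degen _ _]/= chain_degen0 /= mcomp_idl.
by rewrite [chain_degen _ _]/= chain_faceS IH.
Qed.

Lemma chain_face_degen_succ n a (c : chain n a) i : (i <= n)%N ->
  chain_face (chain_degen c i) i = (1, c).
Proof.
elim: c i => [{}a|{}n {}a b f c IH] [|i] ni //=.
- by rewrite aug_id.
- by rewrite mcomp_idr.
- by rewrite -/(chain_face (chain_cons f (chain_degen c i)) i.+1) chain_faceS IH.
Qed.

Lemma chain_face_degen_gt n a (c : chain n.+1 a) i j : (j <= i <= n)%N ->
  chain_face (chain_degen c j) i.+1 =
  ((chain_face c i).1, chain_degen (chain_face c i).2 j).
Proof.
elim: n a c i j => [|n IH] a c i [|j] ij; rewrite ?(chain_degen0, chain_faceS) //.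
  by case: i ij => [|i]; rewrite ?ltn0 ?andbF.
have [b [f [c1 ->]]] := chain_consP c; case: i ij => [|i] // ij.
by rewrite [chain_degen _ _]/= !chain_faceS IH.
Qed.

Lemma word_face_face n (w : word n.+2) i j : (i < j <= n.+2)%N ->
  ((word_face j w).1 * (word_face i (word_face j w).2).1,
   (word_face i (word_face j w).2).2) =
  ((word_face i w).1 * (word_face j.-1 (word_face i w).2).1,
   (word_face j.-1 (word_face i w).2).2).
Proof.
case: w => a c; case: i j => [|i] [|j] // ij; last first.
  rewrite /word_face /=; case: j ij => [|j] // ij.
  have ij' : (i < j.+1 <= n.+1)%N by move: ij; rewrite !ltnS.
  by have [-> ->] := chain_face_face c ij'.
have [b [f [c1 ->]]] := chain_consP c; have [b' [g [c2 ->]]] := chain_consP c1.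
case: j ij => [|j] ij; first by rewrite /= mul1r aug_mcomp mulrC.
by rewrite /word_face [projT2 _]/= chain_faceS /= mulrC.
Qed.

Lemma word_face_degen_lt n (w : word n.+1) i j : (i < j <= n.+1)%N ->
  word_face i (word_degen j w) =
  ((word_face i w).1, word_degen j.-1 (word_face i w).2).
Proof.
case: w => a c; case: i j => [|i] [|j] // ij.
  by have [b [f [c1 ->]]] := chain_consP c.
by rewrite /word_face /= chain_face_degen_lt.
Qed.

Lemma word_face_degen_id n (w : word n) i : (i <= n)%N ->
  word_face i (word_degen i w) = (1, w).
Proof.
case: w => a c; case: i => [|i] ni.
  by rewrite /word_face /word_degen /= chain_degen0 /= aug_id.
by rewrite /word_face /= chain_face_degen_id.
Qed.

Lemma word_face_degen_succ n (w : word n) i : (i <= n)%N ->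
  word_face i.+1 (word_degen i w) = (1, w).
Proof. by case: w => a c ni; rewrite /word_face /= chain_face_degen_succ. Qed.

Lemma word_face_degen_gt n (w : word n.+1) i j : (j.+1 < i <= n.+2)%N ->
  word_face i (word_degen j w) =
  ((word_face i.-1 w).1, word_degen j (word_face i.-1 w).2).
Proof.
by case: w => a c; case: i => [|[|i]] // ij; rewrite /word_face /= chain_face_degen_gt.
Qed.

Lemma lnerve_face_face n i j x : (i < j <= n.+2)%N ->
  lnerve_face n i (lnerve_face n.+1 j x) =
  lnerve_face n j.-1 (lnerve_face n.+1 i x).
Proof.
move=> ij.
have H w : lnerve_face n i (lnerve_face n.+1 j (tensor w)) =
    lnerve_face n j.-1 (lnerve_face n.+1 i (tensor w)).
  rewrite !lnerve_face_tensor !linearZ_LR !lnerve_face_tensor.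
  by have [e1 e2] := word_face_face w ij; rewrite !scalerA e1 e2.
exact: (@lnerve_ext _ _ (lnerve_face n i \o lnerve_face n.+1 j)
  (lnerve_face n j.-1 \o lnerve_face n.+1 i) H x).
Qed.

Lemma lnerve_degen_degen n i j x : (i <= j <= n)%N ->
  lnerve_degen n.+1 i (lnerve_degen n j x) =
  lnerve_degen n.+1 j.+1 (lnerve_degen n i x).
Proof.
move=> ij.
have H w : lnerve_degen n.+1 i (lnerve_degen n j (tensor w)) =
    lnerve_degen n.+1 j.+1 (lnerve_degen n i (tensor w)).
  by rewrite !lnerve_degen_tensor /word_degen chain_degen_degen.
exact: (@lnerve_ext _ _ (lnerve_degen n.+1 i \o lnerve_degen n j)
  (lnerve_degen n.+1 j.+1 \o lnerve_degen n i) H x).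
Qed.

Lemma lnerve_face_degen_lt n i j x : (i < j <= n.+1)%N ->
  lnerve_face n.+1 i (lnerve_degen n.+1 j x) =
  lnerve_degen n j.-1 (lnerve_face n i x).
Proof.
move=> ij.
have H w : lnerve_face n.+1 i (lnerve_degen n.+1 j (tensor w)) =
    lnerve_degen n j.-1 (lnerve_face n i (tensor w)).
  by rewrite lnerve_degen_tensor !lnerve_face_tensor linearZ_LR lnerve_degen_tensor
    word_face_degen_lt.
exact: (@lnerve_ext _ _ (lnerve_face n.+1 i \o lnerve_degen n.+1 j)
  (lnerve_degen n j.-1 \o lnerve_face n i) H x).
Qed.

Lemma lnerve_face_degen_id n i x : (i <= n)%N ->
  lnerve_face n i (lnerve_degen n i x) = x.
Proof.
move=> ni.
have H w : lnerve_face n i (lnerve_degen n i (tensor w)) =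
    (tensor w).
  by rewrite lnerve_degen_tensor lnerve_face_tensor word_face_degen_id // scale1r.
exact: (@lnerve_ext _ _ (lnerve_face n i \o lnerve_degen n i) idfun H x).
Qed.

Lemma lnerve_face_degen_succ n i x : (i <= n)%N ->
  lnerve_face n i.+1 (lnerve_degen n i x) = x.
Proof.
move=> ni.
have H w : lnerve_face n i.+1 (lnerve_degen n i (tensor w)) =
    (tensor w).
  by rewrite lnerve_degen_tensor lnerve_face_tensor word_face_degen_succ // scale1r.
exact: (@lnerve_ext _ _ (lnerve_face n i.+1 \o lnerve_degen n i) idfun H x).
Qed.

Lemma lnerve_face_degen_gt n i j x : (j.+1 < i <= n.+2)%N ->
  lnerve_face n.+1 i (lnerve_degen n.+1 j x) =
  lnerve_degen n j (lnerve_face n i.-1 x).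
Proof.
move=> ij.
have H w : lnerve_face n.+1 i (lnerve_degen n.+1 j (tensor w)) =
    lnerve_degen n j (lnerve_face n i.-1 (tensor w)).
  by rewrite lnerve_degen_tensor !lnerve_face_tensor linearZ_LR lnerve_degen_tensor
    word_face_degen_gt.
exact: (@lnerve_ext _ _ (lnerve_face n.+1 i \o lnerve_degen n.+1 j)
  (lnerve_degen n j \o lnerve_face n i.-1) H x).
Qed.

Definition lnerve : simplicial_module K :=
  SimplicialModule lnerve_face_face lnerve_degen_degen lnerve_face_degen_lt
    lnerve_face_degen_id lnerve_face_degen_succ lnerve_face_degen_gt.

End LinearNerve.

Arguments chain_nil {K A} a.
Arguments chain_cons {K A n a b} f c.
Record quiver := Quiver {
  vert : Type;
  arrow : Type;
  qtail : arrow -> vert;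
  qhead : arrow -> vert;
  qdeg : vert -> arrow;
  qtail_deg : forall v, qtail (qdeg v) = v;
  qhead_deg : forall v, qhead (qdeg v) = v
}.

Arguments qdeg {q} v.

Definition arrows_between (Q : quiver) (u v : vert Q) : set (arrow Q) :=
  [set a | qtail a = u /\ qhead a = v].

Arguments arrows_between Q u v : clear implicits.

Definition power_le (Q : quiver) (p : nat) : Prop :=
  forall u v, (arrows_between Q u v #<= `I_p)%card.

(* The supremum of the cardinalities of the sets Q(u, v), degenerate arrows included,
   is the natural number p. *)
Definition has_power (Q : quiver) (p : nat) : Prop :=
  power_le Q p /\ forall q, power_le Q q -> (p <= q)%N.

Record embedding (Q Q' : quiver) := Embedding {
  emb_vert : vert Q -> vert Q';
  emb_arrow : arrow Q -> arrow Q';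
  emb_vert_inj : injective emb_vert;
  emb_arrow_inj : injective emb_arrow;
  emb_tail : forall a, qtail (emb_arrow a) = emb_vert (qtail a);
  emb_head : forall a, qhead (emb_arrow a) = emb_vert (qhead a);
  emb_deg : forall v, emb_arrow (qdeg v) = qdeg (emb_vert v)
}.

Section PowerQuiver.
Variables (k : nat) (V : Type).

Variant power_arrow :=
  | power_deg (v : V)
  | power_gen (v v' : V) (i : 'I_k).

Definition power_tail (a : power_arrow) : V :=
  match a with power_deg v => v | power_gen v _ _ => v end.

Definition power_head (a : power_arrow) : V :=
  match a with power_deg v => v | power_gen _ v' _ => v' end.

Definition power_quiver : quiver :=
  @Quiver V power_arrow power_tail power_head power_deg
    (fun=> erefl) (fun=> erefl).

End PowerQuiver.

Definition arrow_in (Q : quiver) (u v : vert Q) (a : arrow Q)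
    (ta : qtail a = u) (ha : qhead a = v) : arrows_between Q u v :=
  exist _ a (mem_set (conj ta ha)).

Lemma arrow_in_eq (Q : quiver) (u v : vert Q) (a a' : arrow Q)
    (ta : qtail a = u) (ha : qhead a = v) (ta' : qtail a' = u) (ha' : qhead a' = v) :
  a = a' -> arrow_in ta ha = arrow_in ta' ha'.
Proof. by move=> e; apply: val_inj. Qed.

Lemma arrow_inP (Q : quiver) (u v : vert Q) (x : arrows_between Q u v) :
  exists a (ta : qtail a = u) (ha : qhead a = v), x = arrow_in ta ha.
Proof.
case: x => a h; have [ta ha] := set_mem h.
by exists a, ta, ha; apply: val_inj.
Qed.

Definition invertible (K : pzRingType) (x : K) : Prop := exists y, x * y = 1.

Definition inverse (K : pzRingType) (x : K) (hx : invertible x) : K := sval (cid hx).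

Lemma mul_inverse (K : pzRingType) (x : K) (hx : invertible x) : x * inverse hx = 1.
Proof. exact: (svalP (cid hx)). Qed.

Section PowerCategory.
Variables (K : comPzRingType) (k : nat) (hk : invertible (k%:R : K)) (V : Type).

Local Notation Q := (power_quiver k V).

Definition power_hom (v v' : V) : lmodType K := free_mod K (arrows_between Q v v').

Definition power_id (v : V) : power_hom v v :=
  fbasis K (@arrow_in Q v v (power_deg k v) erefl erefl).

Definition power_basis (v v' : V) (i : 'I_k) : power_hom v v' :=
  fbasis K (@arrow_in Q v v' (power_gen v v' i) erefl erefl).

(* The composite of two basis arrows: identities are neutral, and any two generators
   compose to the average of the generators. *)
Definition power_comp_arrow (v v' v'' : V) (b a : arrow Q) :
    qtail b = v' -> qhead b = v'' -> qtail a = v -> qhead a = v' -> power_hom v v'' :=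
  match a return
    qtail b = v' -> qhead b = v'' -> @qtail Q a = v -> @qhead Q a = v' -> power_hom v v''
  with
  | power_deg w => fun tb hb ta ha =>
      fbasis K (@arrow_in Q v v'' b (etrans tb (etrans (esym ha) ta)) hb)
  | power_gen w w' i =>
    match b return
      @qtail Q b = v' -> @qhead Q b = v'' -> w = v -> w' = v' -> power_hom v v''
    with
    | power_deg u => fun tb hb ta ha =>
        fbasis K (@arrow_in Q v v'' (power_gen w w' i) ta
                    (etrans ha (etrans (esym tb) hb)))
    | power_gen _ _ _ => fun _ _ _ _ =>
        inverse hk *: \sum_(j < k) power_basis v v'' j
    end
  end.

Definition power_comp_basis (v v' v'' : V)
    (b : arrows_between Q v' v'') (a : arrows_between Q v v') : power_hom v v'' :=
  power_comp_arrow (set_valP b).1 (set_valP b).2 (set_valP a).1 (set_valP a).2.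

Definition power_comp (v v' v'' : V) (g : power_hom v' v'') (f : power_hom v v') :
    power_hom v v'' :=
  free_lift (fun b => free_lift (fun a => power_comp_basis b a) f) g.

Definition power_aug (v v' : V) : {linear power_hom v v' -> K^o} :=
  free_lift (M := K^o) (fun=> 1).

Lemma power_comp_linearl v v' v'' r (g g' : power_hom v' v'') (f : power_hom v v') :
  power_comp (r *: g + g') f = r *: power_comp g f + power_comp g' f.
Proof. by rewrite /power_comp linearP. Qed.

Lemma power_comp_linearr v v' v'' r (g : power_hom v' v'') (f f' : power_hom v v') :
  power_comp g (r *: f + f') = r *: power_comp g f + power_comp g f'.
Proof.
rewrite /power_comp /= /free_lift_fun scaler_sumr -big_split; apply: eq_bigr => b _ /=.
rewrite -!/(free_lift_fun _ _) free_lift_linear scalerDr !scalerA.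
by rewrite mulrC.
Qed.

Definition power_compl v v' v'' (f : power_hom v v') :
    {linear power_hom v' v'' -> power_hom v v''} :=
  mk_linear (fun r g g' => power_comp_linearl r g g' f).

Definition power_compr v v' v'' (g : power_hom v' v'') :
    {linear power_hom v v' -> power_hom v v''} :=
  mk_linear (fun r f f' => power_comp_linearr r g f f').

Lemma power_comp_basisE v v' v'' (b a : arrow Q)
    (tb : qtail b = v') (hb : qhead b = v'') (ta : qtail a = v) (ha : qhead a = v') :
  power_comp (fbasis K (arrow_in tb hb)) (fbasis K (arrow_in ta ha)) =
  power_comp_arrow tb hb ta ha.
Proof.
rewrite /power_comp !free_lift_basis /power_comp_basis.
by congr power_comp_arrow; apply: Prop_irrelevance.
Qed.

Lemma power_comp_idl v v' (f : power_hom v v') : power_comp (power_id v') f = f.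
Proof.
move: f; refine (@free_ext _ _ _ (power_compr v (power_id v')) idfun _) => x.
have [a [ta [ha ->]]] := arrow_inP x; rewrite mk_linearE /power_id power_comp_basisE.
case: a ta ha => [w|w w' i] ta ha; last by congr fbasis; apply: arrow_in_eq.
by congr fbasis; apply: arrow_in_eq; move: ha => /= ->.
Qed.

Lemma power_comp_idr v v' (f : power_hom v v') : power_comp f (power_id v) = f.
Proof.
move: f; refine (@free_ext _ _ _ (power_compl v' (power_id v)) idfun _) => x.
have [a [ta [ha ->]]] := arrow_inP x; apply: etrans (power_comp_basisE _ _ _ _) _.
case: a ta ha => [w|w w' i] ta ha /=;by congr fbasis; apply: arrow_in_eq.
Qed.

Definition power_avg v v' : power_hom v v' :=
  inverse hk *: \sum_(j < k) power_basis v v' j.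

Lemma power_comp_gen v v' v'' i j :
  power_comp (power_basis v' v'' i) (power_basis v v' j) = power_avg v v''.
Proof. exact: power_comp_basisE. Qed.

Lemma power_avg_sum (M : lmodType K) (x : M) : inverse hk *: \sum_(j < k) x = x.
Proof.
by rewrite sumr_const card_ord -scaler_nat scalerA mulrC mul_inverse scale1r.
Qed.

Lemma power_comp_avgl v v' v'' j :
  power_comp (power_avg v' v'') (power_basis v v' j) = power_avg v v''.
Proof.
apply: etrans (linearZ_LR (power_compl v'' (power_basis v v' j)) _ _) _.
rewrite (raddf_sum (power_compl v'' (power_basis v v' j))).
rewrite -[RHS]power_avg_sum; congr (_ *: _).
by apply: eq_bigr => i _; apply: power_comp_gen.
Qed.

Lemma power_comp_avgr v v' v'' i :
  power_comp (power_basis v' v'' i) (power_avg v v') = power_avg v v''.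
Proof.
apply: etrans (linearZ_LR (power_compr v (power_basis v' v'' i)) _ _) _.
rewrite (raddf_sum (power_compr v (power_basis v' v'' i))).
rewrite -[RHS]power_avg_sum; congr (_ *: _).
by apply: eq_bigr => j _; apply: power_comp_gen.
Qed.

Variant power_basis_spec v : forall v', power_hom v v' -> Prop :=
  | PowerBasisId : power_basis_spec (power_id v)
  | PowerBasisGen v' i : power_basis_spec (power_basis v v' i).

Lemma power_basisP v v' (x : arrows_between Q v v') : power_basis_spec (fbasis K x).
Proof.
have [a [ta [ha ->]]] := arrow_inP x; case: a ta ha => [w|w w' i] ta ha.
  by simpl in ta, ha; subst w v'; exact: PowerBasisId.
by simpl in ta, ha; subst w w'; exact: PowerBasisGen.
Qed.

Lemma power_compA v v' v'' v3 (h : power_hom v'' v3) (g : power_hom v' v'')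
    (f : power_hom v v') :
  power_comp h (power_comp g f) = power_comp (power_comp h g) f.
Proof.
move: h; refine (@free_ext _ _ _ (power_compl v3 (power_comp g f))
  (power_compl v3 f \o power_compl v3 g) _) => z.
rewrite -[LHS]/(power_comp (fbasis K z) (power_comp g f)).
rewrite -[RHS]/(power_comp (power_comp (fbasis K z) g) f).
move: g; refine (@free_ext _ _ _ (power_compr v (fbasis K z) \o power_compl v'' f)
  (power_compl v3 f \o power_compr v' (fbasis K z)) _) => y.
rewrite -[LHS]/(power_comp (fbasis K z) (power_comp (fbasis K y) f)).
rewrite -[RHS]/(power_comp (power_comp (fbasis K z) (fbasis K y)) f).
move: f; refine (@free_ext _ _ _ (power_compr v (fbasis K z) \o power_compr v (fbasis K y))
  (power_compr v (power_comp (fbasis K z) (fbasis K y))) _) => x.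
rewrite -[LHS]/(power_comp (fbasis K z) (power_comp (fbasis K y) (fbasis K x))).
rewrite -[RHS]/(power_comp (power_comp (fbasis K z) (fbasis K y)) (fbasis K x)).
case: {v3 z}_ / (power_basisP z) => [|v3 l]; first by rewrite !power_comp_idl.
case: {v'' y}_ / (power_basisP y) => [|v'' m]; first by rewrite power_comp_idl power_comp_idr.
case: {v' x}_ / (power_basisP x) => [|v' n]; first by rewrite !power_comp_idr.
by rewrite !power_comp_gen power_comp_avgl power_comp_avgr.
Qed.

Lemma power_aug_basis v v' (x : arrows_between Q v v') : power_aug v v' (fbasis K x) = 1.
Proof. exact: free_lift_basis. Qed.

Lemma power_aug_avg v v' : power_aug v v' (power_avg v v') = 1.
Proof.
apply: etrans (linearZ_LR (power_aug v v') _ _) _; rewrite (raddf_sum (power_aug v v')).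
apply: etrans _ (power_avg_sum (1 : K^o)); congr (_ *: _).
by apply: eq_bigr => i _; apply: power_aug_basis.
Qed.

Lemma power_aug_comp v v' v'' (g : power_hom v' v'') (f : power_hom v v') :
  power_aug v v'' (power_comp g f) = (power_aug v' v'' g : K) * power_aug v v' f.
Proof.
rewrite [RHS]mulrC; move: g.
refine (@free_ext _ _ _ (power_aug v v'' \o power_compl v'' f)
  ( *:%R (power_aug v v' f) \o power_aug v' v'') _) => y.
rewrite -[LHS]/(power_aug v v'' (power_comp (fbasis K y) f)).
rewrite -[RHS]/((power_aug v v' f : K) * power_aug v' v'' (fbasis K y)).
rewrite power_aug_basis mulr1; move: f.
refine (@free_ext _ _ _ (power_aug v v'' \o power_compr v (fbasis K y)) (power_aug v v') _) => x.
rewrite power_aug_basis -[LHS]/(power_aug v v'' (power_comp (fbasis K y) (fbasis K x))).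
case: {v'' y}_ / (power_basisP y) => [|v'' j]; first by rewrite power_comp_idl power_aug_basis.
case: {v' x}_ / (power_basisP x) => [|v' i]; first by rewrite power_comp_idr power_aug_basis.
by rewrite power_comp_gen power_aug_avg.
Qed.

Definition power_category : aug_lincat K :=
  AugLinCat power_comp_linearl power_comp_linearr power_comp_idl power_comp_idr
    power_compA (fun v => power_aug_basis _) power_aug_comp.

End PowerCategory.
Lemma embedding_exists (Q : quiver) (k : nat) : power_le Q k ->
  exists i : embedding Q (power_quiver k (vert Q)), forall v, emb_vert i v = v.
Proof.
move=> hQ.
have inj u v : exists f : arrows_between Q u v -> 'I_k, injective f.
  have /card_leP[f] := hQ u v.
  have fk x : (set_val (f x) < k)%N by exact: (set_valP (f x)).
  exists (fun x => Ordinal (fk x)) => x y /(congr1 val) /= /val_inj.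
  by apply: (@inj _ _ [set: _] f); rewrite inE.
have {}inj u v := cid (inj u v).
pose f u v := sval (inj u v).
have f_inj u v : injective (f u v) := svalP (inj u v).
pose g (a : arrow Q) : 'I_k := f _ _ (arrow_in (a := a) erefl erefl).
have gE a u v (ta : qtail a = u) (ha : qhead a = v) : g a = f u v (arrow_in ta ha).
  by subst u v.
pose e (a : arrow Q) : arrow (power_quiver k (vert Q)) :=
  if pselect (exists v, a = qdeg v) is left h then power_deg k (sval (cid h))
  else power_gen (qtail a) (qhead a) (g a).
have e_deg v : e (qdeg v) = power_deg k v.
  rewrite /e; case: pselect => [h|[]]; last by exists v.
  case: (cid h) => w /= /(congr1 (@qtail Q)).
  by rewrite !qtail_deg => ->.
have e_tail a : qtail (e a) = qtail a.
  by rewrite /e; case: pselect => //= h; case: (cid h) => w /= ->; rewrite qtail_deg.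
have e_head a : qhead (e a) = qhead a.
  by rewrite /e; case: pselect => //= h; case: (cid h) => w /= ->; rewrite qhead_deg.
have e_inj : injective e.
  move=> a b; rewrite /e; case: pselect => h; case: pselect => h' //.
    by case: (cid h) => w /= ->; case: (cid h') => w' /= -> [->].
  case=> et eh; rewrite (gE a _ _ et eh) => /f_inj/(congr1 (@set_val _ _)).
  by [].
by exists (@Embedding Q (power_quiver k (vert Q)) id e (fun _ _ => id) e_inj
  e_tail e_head e_deg).
Qed.

Section PowerComplex.
Variables (K : comPzRingType) (k : nat) (hk : invertible (k%:R : K)).
Variables (Q : quiver) (i : embedding Q (power_quiver k (vert Q))).

Local Notation A := (power_category hk (vert Q)).

(* Strings alpha_1, ..., alpha_n all of whose entries are (basis elements given by)
   arrows of i(Q). *)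
Inductive quiver_chain : forall n (a : A), chain n a -> Prop :=
  | quiver_chain_nil a : quiver_chain (chain_nil a)
  | quiver_chain_cons n (u v : A) (a : arrow Q) (ta : qtail (emb_arrow i a) = u)
      (ha : qhead (emb_arrow i a) = v) (c : chain n v) :
      quiver_chain c ->
      quiver_chain (chain_cons (fbasis K (arrow_in ta ha) : hom A u v) c).

Definition quiver_sub n : submodClosed (lnerve A n) :=
  span [set x | exists (a : A) (c : chain n a),
    quiver_chain c /\ x = tensor (existT _ a c)].

(* The complex Omega^(k) Q computed with the embedding i. *)
Definition power_complex : chain_complex K :=
  @omega K (moore (lnerve A))
    (fun n => image_sub (quot_pi (degenerate (lnerve A) n)) (quiver_sub n)).

Definition power_homology n : lmodType K := homology power_complex n.

End PowerComplex.

(* Main.v *)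
Require Import Defs.
From HB Require Import structures.
From mathcomp Require Import all_boot all_algebra.
From mathcomp Require Import boolp classical_sets functions cardinality.
(* [hom] and [span] are shadowed by mathcomp's vector library. *)
Import Defs.
Set Implicit Arguments.
Unset Strict Implicit.
Unset Printing Implicit Defensive.
Import GRing.Theory.
Local Open Scope ring_scope.

(* In the category A^k_V, arrows x and y in the span of the generators always satisfy
   y o x = eps(y) eps(x) avg, where avg is the average of the k generators. Hence a
   linear map on hom modules that preserves identities, augmentation and avg, and keeps
   generators in the span of generators, is automatically a functor. As Q(u, v) has fewer
   than k elements, some generator u -> v of A^k_V lies outside the image of Q; by
   choosing its value one obtains an augmented functor F : A^k_V -> A^l_V that sends
   i(a) to j(a) for each arrow a of Q and avg to avg. Symmetrically there is
   G : A^l_V -> A^k_V sending j(a) back to i(a). The induced chain maps exchange the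
   submodules spanned by the strings of arrows of Q and are mutually inverse on them,
   so they restrict to mutually inverse maps of the omega complexes. *)

(** * Functoriality of homology *)

Section HomologyMap.
Variables (K : pzRingType) (C D : chain_complex K).
Variable f : forall n, {linear C n -> D n}.
Hypothesis f_bd : forall n x, f n (bd C n x) = bd D n (f n.+1 x).

Lemma cycles_map n x : x \in cycles C n -> f n x \in cycles D n.
Proof.
case: n x => // n x; rewrite !unfold_in => /eqP xC.
by rewrite /ker_pred -f_bd xC linear0.
Qed.

Definition cycle_map_fun n (x : submod (cycles C n)) : submod (cycles D n) :=
  Submod (cycles_map (valP x)).

Lemma cycle_map_linear n : linear (@cycle_map_fun n).
Proof.
move=> r x y; apply: val_inj.
apply: etrans (esym (submod_val_linear _ _ _)).
by apply: (etrans (congr1 (f n) (submod_val_linear _ _ _))); rewrite linearP.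
Qed.

Definition cycle_map n : {linear submod (cycles C n) -> submod (cycles D n)} :=
  mk_linear (@cycle_map_linear n).

Lemma boundaries_map n x : x \in boundaries C n ->
  (quot_pi (boundaries D n) \o cycle_map n) x = 0.
Proof.
move=> /asboolP[y _ yx]; apply/quot_pi0/asboolP; exists (f n.+1 y) => //.
by rewrite -f_bd yx.
Qed.

Definition homology_map n : {linear homology C n -> homology D n} :=
  quot_lift (@boundaries_map n).

Lemma homology_map_pi n x :
  homology_map n (quot_pi _ x) = quot_pi _ (cycle_map n x).
Proof. exact: quot_lift_pi. Qed.

End HomologyMap.

Lemma homology_mapK (K : pzRingType) (C D : chain_complex K)
    (f : forall n, {linear C n -> D n}) (g : forall n, {linear D n -> C n})
    (f_bd : forall n x, f n (bd C n x) = bd D n (f n.+1 x))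
    (g_bd : forall n x, g n (bd D n x) = bd C n (g n.+1 x)) n :
  cancel (f n) (g n) -> cancel (homology_map f_bd n) (homology_map g_bd n).
Proof.
move=> fK x; have [y <-] := quot_pi_surj x; rewrite !homology_map_pi.
by congr (quot_pi _ _); apply: val_inj; apply: fK.
Qed.

(** The inverses of the components are automatically linear and commute with the boundaries, so they
    form a chain map, which induces the inverse on homology. *)
Lemma chain_iso_homology (K : pzRingType) (C D : chain_complex K) n :
  chain_iso C D -> module_iso (homology C n) (homology D n).
Proof.
case=> f [f_bij f_bd].
have inv m : {g : {linear D m -> C m} | cancel (f m) g /\ cancel g (f m)}.
  apply: cid; case: (f_bij m) => g fK gK.
  have g_lin : linear g by move=> r x y; rewrite -[RHS]fK linearP !gK.
  by exists (mk_linear g_lin).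
pose g m := sval (inv m).
have fK m : cancel (f m) (g m) := (svalP (inv m)).1.
have gK m : cancel (g m) (f m) := (svalP (inv m)).2.
have g_bd m x : g m (bd D m x) = bd C m (g m.+1 x).
  by rewrite -[RHS]fK f_bd gK.
exists (homology_map f_bd n); exists (homology_map g_bd n);
  exact: homology_mapK.
Qed.

(** * Restriction of chain maps to omega complexes *)

Section OmegaMap.
Variables (K : pzRingType) (C C' : chain_complex K).
Variables (D : forall n, submodClosed (C n)) (D' : forall n, submodClosed (C' n)).
Variable f : forall n, {linear C n -> C' n}.
Hypothesis f_bd : forall n x, f n (bd C n x) = bd C' n (f n.+1 x).
Hypothesis f_D : forall n x, x \in D n -> f n x \in D' n.

Lemma omega_sub_map n x : x \in omega_sub D n -> f n x \in omega_sub D' n.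
Proof.
case: n x => [|n] x; first exact: f_D.
by case/andP=> xD dxD; apply/andP; split; [|rewrite unfold_in -f_bd]; apply: f_D.
Qed.

Definition omega_map_fun n (x : omega D n) : omega D' n :=
  Submod (omega_sub_map (valP x)).

Lemma omega_map_linear n : linear (@omega_map_fun n).
Proof.
move=> r x y; apply: val_inj.
apply: etrans (esym (submod_val_linear _ _ _)).
by apply: (etrans (congr1 (f n) (submod_val_linear _ _ _))); rewrite linearP.
Qed.

Definition omega_map n : {linear omega D n -> omega D' n} :=
  mk_linear (@omega_map_linear n).

Lemma omega_map_bd n x :
  omega_map n (bd (omega D) n x) = bd (omega D') n (omega_map n.+1 x).
Proof. by apply: val_inj; apply: f_bd. Qed.

End OmegaMap.

Lemma omega_sub_le (K : pzRingType) (C : chain_complex K)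
    (D : forall n, submodClosed (C n)) n x : x \in omega_sub D n -> x \in D n.
Proof. by case: n x => // n x /andP[]. Qed.

(** Being mutually inverse on [D] and [D'] is enough, since [omega_sub] lies inside them. This form
    matters because the two transfer functors need not be mutually inverse on all morphisms. *)
Lemma omega_iso (K : pzRingType) (C C' : chain_complex K)
    (D : forall n, submodClosed (C n)) (D' : forall n, submodClosed (C' n))
    (f : forall n, {linear C n -> C' n}) (g : forall n, {linear C' n -> C n}) :
  (forall n x, f n (bd C n x) = bd C' n (f n.+1 x)) ->
  (forall n x, g n (bd C' n x) = bd C n (g n.+1 x)) ->
  (forall n x, x \in D n -> f n x \in D' n) ->
  (forall n x, x \in D' n -> g n x \in D n) ->
  (forall n x, x \in D n -> g n (f n x) = x) ->
  (forall n x, x \in D' n -> f n (g n x) = x) ->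
  chain_iso (omega D) (omega D').
Proof.
move=> f_bd g_bd fD gD fK gK; exists (omega_map f_bd fD).
split=> [n|]; last exact: omega_map_bd.
exists (omega_map g_bd gD n) => -[x xD]; apply: val_inj => /=.
  exact/fK/(omega_sub_le xD).
exact/gK/(omega_sub_le xD).
Qed.

(** * Functoriality of the Moore complex *)

Section MooreMap.
Variables (K : comPzRingType) (A B : simplicial_module K).
Variable f : forall n, {linear A n -> B n}.
Hypothesis f_face : forall n i x, f n (face A n i x) = face B n i (f n.+1 x).
Hypothesis f_degen : forall n i x, f n.+1 (degen A n i x) = degen B n i (f n x).

Lemma degenerate_map n x : x \in degenerate A n -> f n x \in degenerate B n.
Proof.
case: n x => [|n]; apply: (@span_ind _ _ _ (preimage_sub (f _) (degenerate B _))) => //.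
move=> _ [i [x [le ->]]].
by rewrite unfold_in /preimage_pred f_degen degen_degenerate.
Qed.

Lemma moore_map_subproof n x : x \in degenerate A n ->
  (quot_pi (degenerate B n) \o f n) x = 0.
Proof. by move=> /degenerate_map /quot_pi0. Qed.

Definition moore_map n : {linear moore A n -> moore B n} :=
  quot_lift (@moore_map_subproof n).

Lemma moore_map_pi n x :
  moore_map n (quot_pi (degenerate A n) x) = quot_pi (degenerate B n) (f n x).
Proof. exact: quot_lift_pi. Qed.

Lemma moore_map_bd n x :
  moore_map n (bd (moore A) n x) = bd (moore B) n (moore_map n.+1 x).
Proof.
have [y <-] := quot_pi_surj x.
rewrite moore_map_pi -[bd (moore B) n]/(moore_bd B n) -[bd (moore A) n]/(moore_bd A n).
rewrite !moore_bd_pi moore_map_pi; congr (quot_pi _ _).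
rewrite !mk_linearE /unnorm_bd_fun linear_sum; apply: eq_bigr => i _.
by rewrite linearZ f_face.
Qed.

End MooreMap.

(** * Augmented functors and their action on the linear nerve *)

Record aug_functor (K : comPzRingType) (A B : aug_lincat K) := AugFunctor {
  fob :> A -> B;
  fhom : forall a b, {linear hom A a b -> hom B (fob a) (fob b)};
  fhom_id : forall a, fhom a a (idm a) = idm (fob a);
  fhom_comp : forall a b c (g : hom A b c) (f : hom A a b),
    fhom a c (mcomp g f) = mcomp (fhom b c g) (fhom a b f);
  fhom_aug : forall a b (f : hom A a b), aug (fhom a b f) = aug f
}.
Arguments fhom {K A B} F {a b} : rename.

Section NerveMap.
Variables (K : comPzRingType) (A B : aug_lincat K) (F : aug_functor A B).

Fixpoint chain_map n (a : A) (c : chain n a) : chain n (F a) :=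
  match c with
  | chain_nil a => chain_nil (F a)
  | chain_cons n a b f c => chain_cons (fhom F f) (chain_map c)
  end.

Definition word_map n (w : word A n) : word B n :=
  existT _ (F (projT1 w)) (chain_map (projT2 w)).

Lemma chain_map_lin n r a (c c1 c2 : chain n a) : chain_lin r c c1 c2 ->
  chain_lin r (chain_map c) (chain_map c1) (chain_map c2).
Proof.
by elim=> *; rewrite /= ?linearP; [apply: chain_lin_head|apply: chain_lin_tail].
Qed.

(** Inner faces are preserved by [fhom_comp]; the last face, which drops an arrow and keeps its
    augmentation as a coefficient, is preserved by [fhom_aug]. *)
Lemma chain_face_map n a (c : chain n.+1 a) i :
  chain_face (chain_map c) i =
  ((chain_face c i).1, chain_map (chain_face c i).2).
Proof.
elim: n a c i => [|n IH] a c i; have [b [f [c1 ->]]] := chain_consP c.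
  by rewrite [c1]chain_nilP /= fhom_aug.
case: i => [|i]; last by rewrite [chain_map _]/= !chain_faceS IH.
by have [b' [g [c2 ->]]] := chain_consP c1; rewrite /= fhom_comp.
Qed.

Lemma word_face_map n i (w : word A n.+1) :
  word_face i (word_map w) = ((word_face i w).1, word_map (word_face i w).2).
Proof.
case: w => a c; case: i => [|i]; last by rewrite /= chain_face_map.
by have [b [f [c1 ->]]] := chain_consP c; rewrite /= fhom_aug.
Qed.

Lemma chain_degen_map n a (c : chain n a) i :
  chain_degen (chain_map c) i = chain_map (chain_degen c i).
Proof. by elim: c i => [{}a|{}n {}a b f c IH] [|i] /=; rewrite ?fhom_id ?IH. Qed.

Lemma word_degen_map n i (w : word A n) :
  word_degen i (word_map w) = word_map (word_degen i w).
Proof. by rewrite /word_degen /word_map /= chain_degen_map. Qed.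

Lemma tensor_map_lin n r a (c c1 c2 : chain n a) : chain_lin r c c1 c2 ->
  tensor (word_map (existT _ a c)) =
  r *: tensor (word_map (existT _ a c1)) + tensor (word_map (existT _ a c2)).
Proof. by move=> /chain_map_lin /tensor_lin. Qed.

Definition lnerve_map n : {linear lnerve A n -> lnerve B n} :=
  lnerve_lift (phi := fun w => tensor (word_map w)) (@tensor_map_lin n).

Lemma lnerve_map_tensor n w : lnerve_map n (tensor w) = tensor (word_map w).
Proof. exact: lnerve_lift_tensor. Qed.

Lemma lnerve_map_face n i x :
  lnerve_map n (face (lnerve A) n i x) = face (lnerve B) n i (lnerve_map n.+1 x).
Proof.
move: x; apply: (@lnerve_ext _ _ _ _ (lnerve_map n \o lnerve_face A n i)
  (lnerve_face B n i \o lnerve_map n.+1)) => w.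
rewrite -[LHS]/(lnerve_map n (lnerve_face A n i (tensor w))).
rewrite -[RHS]/(lnerve_face B n i (lnerve_map n.+1 (tensor w))) lnerve_map_tensor.
by rewrite !lnerve_face_tensor linearZ_LR lnerve_map_tensor word_face_map.
Qed.

Lemma lnerve_map_degen n i x :
  lnerve_map n.+1 (degen (lnerve A) n i x) = degen (lnerve B) n i (lnerve_map n x).
Proof.
move: x; apply: (@lnerve_ext _ _ _ _ (lnerve_map n.+1 \o lnerve_degen A n i)
  (lnerve_degen B n i \o lnerve_map n)) => w.
rewrite -[LHS]/(lnerve_map n.+1 (lnerve_degen A n i (tensor w))).
rewrite -[RHS]/(lnerve_degen B n i (lnerve_map n (tensor w))) lnerve_map_tensor.
by rewrite !lnerve_degen_tensor lnerve_map_tensor word_degen_map.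
Qed.

End NerveMap.

(** * Generators of the power categories and their span *)

Lemma span_ext (K : pzRingType) (V W : lmodType K) (S : set V)
    (f g : {linear V -> W}) :
  (forall x, S x -> f x = g x) -> forall x, x \in span S -> f x = g x.
Proof.
move=> fg x xS; apply/eqP; rewrite -subr_eq0; move: x xS.
(* The elements on which [f] and [g] agree form the kernel of [f - g], a submodule. *)
apply: (@span_ind _ _ _ (ker_sub (f \- g))) => x Sx.
by rewrite unfold_in /ker_pred /= fg // subrr.
Qed.

Definition gen_arrow (k : nat) (V : Type) (v v' : V) (n : 'I_k) :
    arrows_between (power_quiver k V) v v' :=
  @arrow_in (power_quiver k V) v v' (power_gen v v' n) erefl erefl.

(** A degenerate arrow forces [v = v']; stating that case through [val x] avoids a transport along
    this equation. *)
Lemma power_arrowP (k : nat) (V : Type) (v v' : V)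
    (x : arrows_between (power_quiver k V) v v') :
  (exists w, val x = power_deg k w) \/ (exists n, x = gen_arrow v v' n).
Proof.
have [a [ta [ha ->]]] := arrow_inP x; case: a ta ha => [w|w w' n] ta ha.
  by left; exists w.
by simpl in ta, ha; subst w w'; right; exists n; apply: arrow_in_eq.
Qed.

Section PowerGenerators.
Variables (K : comPzRingType) (k : nat) (hk : invertible (k%:R : K)) (V : Type).

(** Identities are left out: on the span of the generators alone, composition is determined by the
    augmentations. *)
Definition gen_set (v v' : V) : set (power_hom K k v v') :=
  fun f => exists n, f = power_basis K v v' n.

Definition gen_span (v v' : V) : submodClosed (power_hom K k v v') :=
  span (@gen_set v v').

Lemma mem_gen_span (v v' : V) n : power_basis K v v' n \in gen_span v v'.
Proof. by apply: mem_span; exists n. Qed.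

Lemma avg_in_span (v v' : V) : power_avg hk v v' \in gen_span v v'.
Proof. by apply: rpredZ; apply: rpred_sum => n _; apply: mem_gen_span. Qed.

Lemma power_aug_gen (v v' : V) n : power_aug K k v v' (power_basis K v v' n) = 1.
Proof. exact: power_aug_basis. Qed.

Lemma aug_avg_linear (v v' u u' : V) :
  linear (fun f : power_hom K k v v' => power_aug K k v v' f *: power_avg hk u u').
Proof. by move=> r f g; rewrite linearP scalerDl [in RHS]scalerA. Qed.

(* Both sides are bilinear, and any two generators compose to the average. *)
Lemma power_comp_span (v v' v'' : V) (g : power_hom K k v' v'') (f : power_hom K k v v') :
  g \in gen_span v' v'' -> f \in gen_span v v' ->
  power_comp hk g f =
  power_aug K k v' v'' g *: (power_aug K k v v' f *: power_avg hk v v'').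
Proof.
move=> gS; move: f; refine (@span_ext _ _ _ (@gen_set v v') (power_compr hk v g)
  (power_aug K k v' v'' g \*: mk_linear (@aug_avg_linear v v' v v'')) _) => _ [n ->].
rewrite -[LHS]/(power_comp hk g (power_basis K v v' n)).
rewrite -[RHS]/(power_aug K k v' v'' g *:
  (power_aug K k v v' (power_basis K v v' n) *: power_avg hk v v'')).
rewrite power_aug_gen scale1r; move: g gS.
refine (@span_ext _ _ _ (@gen_set v' v'') (power_compl hk v'' (power_basis K v v' n))
  (mk_linear (@aug_avg_linear v' v'' v v'')) _) => _ [m ->].
rewrite -[LHS]/(power_comp hk (power_basis K v' v'' m) (power_basis K v v' n)).
rewrite -[RHS]/(power_aug K k v' v'' (power_basis K v' v'' m) *: power_avg hk v v'').
by rewrite power_aug_gen scale1r power_comp_gen.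
Qed.

End PowerGenerators.

(** * Arrows of Q inside the power quiver *)

Section EmbeddedArrows.
Variables (k : nat) (Q : quiver) (i : embedding Q (power_quiver k (vert Q))).
Hypothesis i_id : forall v, emb_vert i v = v.

(** The embedding fixes vertices only up to the equation [i_id], which is therefore composed into
    the proofs about the endpoints. *)
Definition emb_between (u v : vert Q) (q : arrows_between Q u v) :
    arrows_between (power_quiver k (vert Q)) u v :=
  arrow_in
    (etrans (emb_tail i (val q)) (etrans (i_id _) (set_valP q).1))
    (etrans (emb_head i (val q)) (etrans (i_id _) (set_valP q).2)).

Lemma emb_between_inj u v : injective (@emb_between u v).
Proof. by move=> q q' /(congr1 val) /emb_arrow_inj /val_inj. Qed.

Lemma emb_betweenP (u v : vert Q) (a : arrow Q)
    (ta : qtail (emb_arrow i a) = u) (ha : qhead (emb_arrow i a) = v) :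
  exists q : arrows_between Q u v, arrow_in ta ha = emb_between q.
Proof.
have ta' : qtail a = u by rewrite -ta emb_tail i_id.
have ha' : qhead a = v by rewrite -ha emb_head i_id.
by exists (arrow_in ta' ha'); apply: arrow_in_eq.
Qed.

(** Otherwise a choice of preimages would inject the [k] generators into Q(u, v), which has at most
    [p < k] elements. *)
Lemma missing_generator p (u v : vert Q) : power_le Q p -> (p < k)%N ->
  exists n : 'I_k, forall q : arrows_between Q u v,
    emb_between q <> gen_arrow u v n.
Proof.
move=> Qp p_lt_k; apply: contrapT => /forallNP all_hit.
have {}all_hit n : {q : arrows_between Q u v | emb_between q = gen_arrow u v n}.
  by apply: cid; apply: contrapT => /forallNP; apply: all_hit.
pose h n := sval (all_hit n).
have h_inj : injective h.
  move=> n n' hnn; have := svalP (all_hit n); have := svalP (all_hit n').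
  by rewrite -/(h n) -/(h n') hnn => -> /(congr1 val) [].
have /card_leP[f] := Qp u v.
have fp x : (set_val (f x) < p)%N by exact: (set_valP (f x)).
have f_inj : injective (fun x => Ordinal (fp x)).
  move=> x y /(congr1 val) /= /val_inj.
  by apply: (@inj _ _ [set: _] f); rewrite inE.
have := leq_card _ (inj_comp f_inj h_inj); rewrite !card_ord.
by rewrite leqNgt p_lt_k.
Qed.

End EmbeddedArrows.

(** * The transfer functor from the k-power to the l-power category *)

Section Transfer.
Variables (K : comPzRingType) (k l : nat).
Variables (hk : invertible (k%:R : K)) (hl : invertible (l%:R : K)).
Variables (Q : quiver) (p : nat) (Q_power : power_le Q p) (p_lt_k : (p < k)%N).
Variable i : embedding Q (power_quiver k (vert Q)).
Hypothesis i_id : forall v, emb_vert i v = v.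
Variable j : embedding Q (power_quiver l (vert Q)).
Hypothesis j_id : forall v, emb_vert j v = v.

Local Notation Qk := (power_quiver k (vert Q)).

(** First approximation to the functor: it has the prescribed values on the arrows of Q and the
    average as a default elsewhere, but need not send the average to the average. *)
Definition transfer_avg (u v : vert Q) (x : arrows_between Qk u v) :
    power_hom K l u v :=
  if pselect (exists q, emb_between i_id q = x) is left h
  then fbasis K (emb_between j_id (sval (cid h))) else power_avg hl u v.

Lemma transfer_avg_emb u v (q : arrows_between Q u v) :
  transfer_avg (emb_between i_id q) = fbasis K (emb_between j_id q).
Proof.
rewrite /transfer_avg; case: pselect => [h|[]]; last by exists q.
by congr (fbasis K (emb_between _ _)); apply: emb_between_inj (svalP (cid h)).
Qed.

Lemma aug_transfer_avg u v (x : arrows_between Qk u v) :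
  power_aug K l u v (transfer_avg x) = 1.
Proof.
by rewrite /transfer_avg; case: pselect => h; rewrite ?power_aug_basis ?power_aug_avg.
Qed.

Definition missing u v : 'I_k :=
  sval (cid (missing_generator i_id u v Q_power p_lt_k)).

Lemma missingP u v (q : arrows_between Q u v) :
  emb_between i_id q <> gen_arrow u v (missing u v).
Proof. exact: (svalP (cid (missing_generator i_id u v Q_power p_lt_k)) q). Qed.

(** What the values of [transfer_avg] on the [k] generators lack to sum to [k] times the average.
    The average and these values all have augmentation 1, so the defect has augmentation
    [k - k = 0]. *)
Definition transfer_defect (u v : vert Q) : power_hom K l u v :=
  k%:R *: power_avg hl u v - \sum_(n < k) transfer_avg (gen_arrow u v n).

(* Adding the defect on one generator outside the image of Q makes the average go
   to the average without changing the values on Q. *)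
Definition transfer_arrow (u v : vert Q) (x : arrows_between Qk u v) :
    power_hom K l u v :=
  transfer_avg x +
  (if `[< x = gen_arrow u v (missing u v) >] then transfer_defect u v else 0).

Definition transfer (u v : vert Q) :
    {linear power_hom K k u v -> power_hom K l u v} :=
  free_lift (@transfer_arrow u v).

Lemma transfer_emb u v (q : arrows_between Q u v) :
  transfer u v (fbasis K (emb_between i_id q)) = fbasis K (emb_between j_id q).
Proof.
rewrite free_lift_basis /transfer_arrow transfer_avg_emb.
by case: asboolP => [e|_]; [case: (missingP e)|rewrite addr0].
Qed.

Lemma transfer_basis u v n :
  transfer u v (power_basis K u v n) = transfer_arrow (gen_arrow u v n).
Proof. exact: free_lift_basis. Qed.

(** Both identities are images of the degenerate arrow of Q at [u], so this is a case of
    [transfer_emb]. *)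
Lemma transfer_id u : transfer u u (power_id K k u) = power_id K l u.
Proof.
have e m (r : embedding Q (power_quiver m (vert Q))) (r_id : forall v, emb_vert r v = v) :
    power_id K m u = fbasis K (emb_between r_id
      (@arrow_in Q u u (qdeg u) (qtail_deg u) (qhead_deg u))).
  by congr fbasis; apply: arrow_in_eq; rewrite /= emb_deg r_id.
by rewrite (e _ _ i_id) transfer_emb -e.
Qed.

(** The defect enters the sum exactly once, at the missing generator. *)
Lemma transfer_arrow_sum u v :
  \sum_(n < k) transfer_arrow (gen_arrow u v n) = k%:R *: power_avg hl u v.
Proof.
rewrite /transfer_arrow big_split /= [X in _ + X](bigD1 (missing u v)) //=.
case: asboolP => // _; rewrite [X in _ + (_ + X)]big1 => [|n nm].
  by rewrite addr0 /transfer_defect addrC subrK.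
by case: asboolP => // /(congr1 val) [] /eqP; rewrite (negPf nm).
Qed.

Lemma transfer_power_avg u v :
  transfer u v (power_avg hk u v) = power_avg hl u v.
Proof.
apply: etrans (linearZ_LR (transfer u v) _ _) _.
rewrite (raddf_sum (transfer u v)) (eq_bigr _ (fun n _ => transfer_basis u v n)).
apply: (etrans (congr1 _ (transfer_arrow_sum u v))).
by rewrite scalerA mulrC mul_inverse scale1r.
Qed.

Lemma aug_transfer u v f :
  power_aug K l u v (transfer u v f) = power_aug K k u v f.
Proof.
move: f; apply: (@free_ext _ _ _ (power_aug K l u v \o transfer u v)) => x.
rewrite -[LHS]/(power_aug K l u v (transfer u v (fbasis K x))).
rewrite power_aug_basis free_lift_basis /transfer_arrow linearD aug_transfer_avg.
case: asboolP => _; last by rewrite linear0 addr0.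
rewrite /transfer_defect linearB linearZ_LR (raddf_sum (power_aug K l u v)) power_aug_avg.
rewrite (eq_bigr _ (fun n _ => aug_transfer_avg (gen_arrow u v n))).
by rewrite sumr_const card_ord scaler_nat subrr addr0.
Qed.

Lemma transfer_avg_gen u v n : transfer_avg (gen_arrow u v n) \in gen_span K l u v.
Proof.
rewrite /transfer_avg; case: pselect => [h|_]; last exact: avg_in_span.
case: (cid h) => q /= /(congr1 val) /= qn.
case: (power_arrowP (emb_between j_id q)) => [[w jq]|[m ->]]; last exact: mem_gen_span.
(* If j(q) were degenerate, injectivity of [j] would make q degenerate in Q, and then i(q) could not
   be a generator. *)
have /emb_arrow_inj qE : emb_arrow j (val q) = emb_arrow j (qdeg w).
  by rewrite emb_deg j_id; exact: jq.
by move: qn; rewrite qE emb_deg.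
Qed.

Lemma transfer_gen u v n : transfer u v (power_basis K u v n) \in gen_span K l u v.
Proof.
rewrite transfer_basis; apply: rpredD; first exact: transfer_avg_gen.
case: asboolP => _; last exact: rpred0.
apply: rpredB; first exact/rpredZ/avg_in_span.
by apply: rpred_sum => m _; apply: transfer_avg_gen.
Qed.

(** By bilinearity it suffices to compare both sides on basis arrows; identities are immediate. *)
Lemma transfer_comp u v w (g : power_hom K k v w) (f : power_hom K k u v) :
  transfer u w (power_comp hk g f) = power_comp hl (transfer v w g) (transfer u v f).
Proof.
move: g; refine (@free_ext _ _ _ (transfer u w \o power_compl hk w f)
  (power_compl hl w (transfer u v f) \o transfer v w) _) => y.
rewrite -[LHS]/(transfer u w (power_comp hk (fbasis K y) f)).
rewrite -[RHS]/(power_comp hl (transfer v w (fbasis K y)) (transfer u v f)).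
move: f; refine (@free_ext _ _ _ (transfer u w \o power_compr hk u (fbasis K y))
  (power_compr hl u (transfer v w (fbasis K y)) \o transfer u v) _) => x.
rewrite -[LHS]/(transfer u w (power_comp hk (fbasis K y) (fbasis K x))).
rewrite -[RHS]/(power_comp hl (transfer v w (fbasis K y)) (transfer u v (fbasis K x))).
case: {w y}_ / (power_basisP K y) => [|w m]; first by rewrite transfer_id !power_comp_idl.
case: {v x}_ / (power_basisP K x) => [|v n]; first by rewrite transfer_id !power_comp_idr.
(* Two generators compose to the average, which goes to the average. Their images lie in the span of
   the generators with augmentation 1, so they compose to the average as well. *)
rewrite power_comp_gen transfer_power_avg power_comp_span ?transfer_gen //.
by rewrite !aug_transfer !power_aug_basis !scale1r.
Qed.

Definition transfer_functor :
    aug_functor (power_category hk (vert Q)) (power_category hl (vert Q)) :=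
  @AugFunctor K (power_category hk (vert Q)) (power_category hl (vert Q)) id transfer
    transfer_id transfer_comp aug_transfer.

Lemma chain_map_emb n (u v : vert Q) (q : arrows_between Q u v)
    (c : @chain K (power_category hk (vert Q)) n v) :
  chain_map transfer_functor
    (chain_cons (fbasis K (emb_between i_id q) : hom (power_category hk (vert Q)) u v) c) =
  chain_cons (fbasis K (emb_between j_id q) : hom (power_category hl (vert Q)) u v)
    (chain_map transfer_functor c).
Proof.
exact: (congr1 (fun f : hom (power_category hl (vert Q)) u v =>
  chain_cons f (chain_map transfer_functor c)) (transfer_emb q)).
Qed.

End Transfer.

(** * The chain maps induced by the two transfer functors *)

Section TransferChain.
Variables (K : comPzRingType) (k l : nat).
Variables (hk : invertible (k%:R : K)) (hl : invertible (l%:R : K)).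
Variables (Q : quiver) (p : nat) (Q_power : power_le Q p).
Variables (p_lt_k : (p < k)%N) (p_lt_l : (p < l)%N).
Variables (i : embedding Q (power_quiver k (vert Q))).
Hypothesis i_id : forall v, emb_vert i v = v.
Variables (j : embedding Q (power_quiver l (vert Q))).
Hypothesis j_id : forall v, emb_vert j v = v.

Local Notation F := (transfer_functor hk hl Q_power p_lt_k i_id j_id).
Local Notation G := (transfer_functor hl hk Q_power p_lt_l j_id i_id).

Lemma quiver_chain_map n (a : power_category hk (vert Q)) (c : chain n a) :
  quiver_chain i c -> quiver_chain j (chain_map F c).
Proof.
elim=> {n a c} [a|n u v a ta ha c _ IH]; first exact: quiver_chain_nil.
have [q ->] := emb_betweenP i_id ta ha.
by rewrite chain_map_emb; apply: quiver_chain_cons.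
Qed.

(** For an arrow a of Q, [F] sends i(a) to j(a) and [G] sends it back. On other strings the
    composite need not be the identity, as generators outside the image of Q can go to averages. *)
Lemma quiver_chain_mapK n (a : power_category hk (vert Q)) (c : chain n a) :
  quiver_chain i c -> chain_map G (chain_map F c) = c.
Proof.
elim=> {n a c} [//|n u v a ta ha c _ IH].
have [q ->] := emb_betweenP i_id ta ha.
by rewrite !chain_map_emb IH.
Qed.

Lemma lnerve_map_quiver_sub n x :
  x \in quiver_sub hk i n -> lnerve_map F n x \in quiver_sub hl j n.
Proof.
move: x; apply: (@span_ind _ _ _ (preimage_sub (lnerve_map F n) (quiver_sub hl j n))).
move=> _ [a [c [cQ ->]]]; rewrite unfold_in /preimage_pred lnerve_map_tensor.
by apply: mem_span; exists a, (chain_map F c); split=> //; apply: quiver_chain_map.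
Qed.

Lemma lnerve_map_quiver_subK n x :
  x \in quiver_sub hk i n -> lnerve_map G n (lnerve_map F n x) = x.
Proof.
move: x; refine (@span_ext _ _ _ _ (lnerve_map G n \o lnerve_map F n) idfun _).
move=> _ [a [c [cQ ->]]].
rewrite -[LHS]/(lnerve_map G n (lnerve_map F n (tensor (existT _ a c)))).
by rewrite !lnerve_map_tensor /word_map /= quiver_chain_mapK.
Qed.

Definition transfer_moore n :
    {linear moore (lnerve (power_category hk (vert Q))) n ->
            moore (lnerve (power_category hl (vert Q))) n} :=
  moore_map (lnerve_map_degen F) n.

Lemma transfer_moore_pi n y :
  transfer_moore n (quot_pi (degenerate (lnerve _) n) y) =
  quot_pi (degenerate (lnerve _) n) (lnerve_map F n y).
Proof. exact: moore_map_pi. Qed.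

Lemma transfer_moore_bd n x :
  transfer_moore n (bd (moore _) n x) = bd (moore _) n (transfer_moore n.+1 x).
Proof. exact/moore_map_bd/lnerve_map_face. Qed.

Lemma transfer_moore_image n x :
  x \in image_sub (quot_pi (degenerate (lnerve _) n)) (quiver_sub hk i n) ->
  transfer_moore n x \in
    image_sub (quot_pi (degenerate (lnerve _) n)) (quiver_sub hl j n).
Proof.
move=> /asboolP[y yQ <-]; rewrite transfer_moore_pi.
by apply/asboolP; exists (lnerve_map F n y) => //; apply: lnerve_map_quiver_sub.
Qed.

End TransferChain.

(** A class in the image submodule has a representative spanned by strings of arrows of Q, which the
    two nerve maps send back to itself. The statement stands outside the section because it takes
    [transfer_moore] in both directions. *)
Lemma transfer_mooreK (K : comPzRingType) (k l : nat)
    (hk : invertible (k%:R : K)) (hl : invertible (l%:R : K))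
    (Q : quiver) (p : nat) (Q_power : power_le Q p)
    (p_lt_k : (p < k)%N) (p_lt_l : (p < l)%N)
    (i : embedding Q (power_quiver k (vert Q)))
    (i_id : forall v, emb_vert i v = v)
    (j : embedding Q (power_quiver l (vert Q)))
    (j_id : forall v, emb_vert j v = v) n x :
  x \in image_sub (quot_pi (degenerate (lnerve _) n)) (quiver_sub hk i n) ->
  transfer_moore hl hk Q_power p_lt_l j_id i_id n
    (transfer_moore hk hl Q_power p_lt_k i_id j_id n x) = x.
Proof.
move=> /asboolP[y yQ <-].
rewrite (transfer_moore_pi hl Q_power p_lt_k i_id j_id y) transfer_moore_pi.
by rewrite (lnerve_map_quiver_subK hl Q_power p_lt_k p_lt_l i_id j_id yQ).
Qed.

(** A power strictly below [k] is finite, hence given as a natural number [p]. The embeddings are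
    arbitrary, so every choice entering the definition of the two complexes is covered. *)
Theorem corollary13p15 (K : comPzRingType) (k l : nat)
    (k_gt0 : (0 < k)%N) (l_gt0 : (0 < l)%N)
    (hk : invertible (k%:R : K)) (hl : invertible (l%:R : K))
    (Q : quiver) (p : nat) (Q_power : has_power Q p)
    (p_lt_k : (p < k)%N) (p_lt_l : (p < l)%N)
    (i : embedding Q (power_quiver k (vert Q)))
    (i_id : forall v, emb_vert i v = v)
    (j : embedding Q (power_quiver l (vert Q)))
    (j_id : forall v, emb_vert j v = v) :
  chain_iso (power_complex hk i) (power_complex hl j) /\
  (forall n, module_iso (power_homology hk i n) (power_homology hl j n)).
Proof.
have [Qp _] := Q_power.
have iso : chain_iso (power_complex hk i) (power_complex hl j).
  (* The bound [p < k] provides the forward map and [p < l] the backward one. *)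
  apply: (omega_iso (f := transfer_moore hk hl Qp p_lt_k i_id j_id)
                    (g := transfer_moore hl hk Qp p_lt_l j_id i_id)).
  - exact: transfer_moore_bd.
  - exact: transfer_moore_bd.
  - exact: transfer_moore_image.
  - exact: transfer_moore_image.
  - exact: transfer_mooreK.
  - exact: transfer_mooreK.
by split=> // n; apply: chain_iso_homology.
Qed.
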